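(* Let $n\ge 4$ and $d,e\in\{1,\dots,n-1\}$ be integers such that $d+e\le n$, and let $j\in\{1,\dots,\min(d,e)\}$. Then $$\mathring\mu_n(d\mid e)_j\ \ge\ \frac{(n-j)\left(jn-jd+\frac{j^2}{2}+\frac{j}{2}+1\right)}{j^2(n-e)\left(n-d+\frac{j}{2}+\frac12\right)}.$$
   Context: $\mathbb{R}^n$ and $\Lambda^2(\mathbb{R}^n)$ carry their canonical Euclidean norms. **Rational subspaces.** A linear subspace $B$ of $\mathbb{R}^n$ is rational if it has a basis of vectors with rational coordinates; $\mathfrak{R}_n(e)$ is the set of rational subspaces of $\mathbb{R}^n$ of dimension $e$. **Height.** For $B\in\mathfrak{R}_n(e)$, the Plücker coordinates of $B$ are the $\binom{n}{e}$ minors of size $e\times e$ of an $n\times e$ matrix whose columns form a basis of $B$ (well defined up to a nonzero scalar); choosing a representative $\Xi$ with integer coordinates with gcd $1$, set $H(B)=\|\Xi\|$ (Euclidean norm). **Angles.** For nonzero $X,Y\in\mathbb{R}^n$ let $\psi(X,Y)=\|X\wedge Y\|/(\|X\|\,\|Y\|)$ (sine of the angle). For subspaces $A,B$ of dimensions $d,e\ge 1$ and $t=\min(d,e)$, define $\psi_1(A,B),\dots,\psi_t(A,B)$ recursively: $\psi_1(A,B)=\min\psi(X,Y)$ over $X\in A\setminus\{0\}$, $Y\in B\setminus\{0\}$, attained at unit vectors $X_1,Y_1$; given $(X_1,Y_1),\dots,(X_j,Y_j)$, $\psi_{j+1}(A,B)=\min\psi(X,Y)$ over nonzero $X\in A$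 orthogonal to $X_1,\dots,X_j$ and nonzero $Y\in B$ orthogonal to $Y_1,\dots,Y_j$, attained at unit vectors $X_{j+1},Y_{j+1}$. (These numbers do not depend on the choices.) **Irrationality and exponents.** Let $d,e\in\{1,\dots,n-1\}$ with $d+e\le n$ and $1\le j\le\min(d,e)$. $\mathfrak{I}_n(d,e)_j$ is the set of $d$-dimensional subspaces $A$ of $\mathbb{R}^n$ with $\dim(A\cap B)<j$ for all $B\in\mathfrak{R}_n(e)$. For $A\in\mathfrak{I}_n(d,e)_j$, $\mu_n(A\mid e)_j\in(0,+\infty]$ is the supremum of the $\beta>0$ such that $\psi_j(A,B)\le H(B)^{-\beta}$ for infinitely many $B\in\mathfrak{R}_n(e)$. Finally $\mathring\mu_n(d\mid e)_j=\inf_{A\in\mathfrak{I}_n(d,e)_j}\mu_n(A\mid e)_j$. *)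

(* Defs.v *)
From HB Require Import structures.
From mathcomp Require Import all_boot all_order all_algebra.
From mathcomp Require Import all_classical all_reals all_analysis.
Set Implicit Arguments.
Unset Strict Implicit.
Unset Printing Implicit Defensive.
Import Order.TTheory GRing.Theory Num.Theory.
Local Open Scope classical_set_scope.
Local Open Scope ring_scope.

(* The library norm on matrices is the sup norm, so the Euclidean structure of
   R^n (column vectors) is spelled out here. *)
Definition dotv (R : realType) (n : nat) (X Y : 'cV[R]_n) : R :=
  \sum_(i < n) X i 0 * Y i 0.

Definition enorm (R : realType) (n : nat) (X : 'cV[R]_n) : R :=
  Num.sqrt (\sum_(i < n) X i 0 ^+ 2).

(* Euclidean norm of X /\ Y, from its coordinates on the e_i /\ e_k, i < k. *)
Definition wedge_norm (R : realType) (n : nat) (X Y : 'cV[R]_n) : R :=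
  Num.sqrt (\sum_(i < n) \sum_(k < n | (i < k)%N)
              (X i 0 * Y k 0 - X k 0 * Y i 0) ^+ 2).

Definition psi (R : realType) (n : nat) (X Y : 'cV[R]_n) : R :=
  wedge_norm X Y / (enorm X * enorm Y).

Definition rational_subspace (R : realType) (n : nat)
    (B : {vspace 'cV[R]_n}) : Prop :=
  exists2 b : seq 'cV[R]_n,
    basis_of B b & forall v, v \in b -> forall i, rational (v i 0).

Definition rational_subspaces (R : realType) (n e : nat) :
    set {vspace 'cV[R]_n} :=
  [set B | rational_subspace B /\ \dim B = e].
Arguments rational_subspaces : clear implicits.

(* A row selection f : 'I_e -> 'I_n is a choice of e rows out of n when it is
   increasing; the increasing selections index the e x e minors. *)
Definition increasing (n e : nat) (f : {ffun 'I_e -> 'I_n}) : bool :=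
  [forall i : 'I_e, forall k : 'I_e, (i < k)%N ==> (f i < f k)%N].

Definition basis_matrix (R : realType) (n : nat) (B : {vspace 'cV[R]_n})
    (M : 'M[R]_(n, \dim B)) : bool :=
  basis_of B [seq col k M | k <- enum 'I_(\dim B)].

(* Xi is a representative of the Pluecker coordinates of B with integer
   coordinates of gcd 1; its values at non-increasing f are irrelevant. *)
Definition primitive_plucker (R : realType) (n : nat) (B : {vspace 'cV[R]_n})
    (Xi : {ffun 'I_(\dim B) -> 'I_n} -> int) : Prop :=
  (exists M : 'M[R]_(n, \dim B), exists c : R,
     [/\ basis_matrix M, c != 0 &
         forall f, increasing f -> (Xi f)%:~R = c * \det (rowsub f M)]) /\
  (\big[gcdn/0%N]_(f : {ffun 'I_(\dim B) -> 'I_n} | increasing f) `|Xi f|%N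
     = 1%N).

(* The norm of any such Xi (they agree up to sign); a default value when there
   is none, i.e. when B is not rational. *)
Definition height (R : realType) (n : nat) (B : {vspace 'cV[R]_n}) : R :=
  xget 0 [set h | exists2 Xi, @primitive_plucker R n B Xi &
    h = Num.sqrt (\sum_(f : {ffun 'I_(\dim B) -> 'I_n} | increasing f)
                    ((Xi f)%:~R : R) ^+ 2)].

Definition orth_to_prev (R : realType) (n : nat) (X : nat -> 'cV[R]_n)
    (i : nat) (v : 'cV[R]_n) : Prop :=
  forall k, (1 <= k < i)%N -> dotv v (X k) = 0.

(* (X_1, Y_1), ..., (X_j, Y_j) is a possible run of the recursive choice of
   minimizing unit vectors; only the indices 1, ..., j matter. *)
Definition principal_vectors (R : realType) (n : nat)
    (A B : {vspace 'cV[R]_n}) (j : nat) (X Y : nat -> 'cV[R]_n) : Prop :=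
  forall i, (1 <= i <= j)%N ->
    [/\ [/\ X i \in A, enorm (X i) = 1 & orth_to_prev X i (X i)],
        [/\ Y i \in B, enorm (Y i) = 1 & orth_to_prev Y i (Y i)] &
        forall x y : 'cV[R]_n,
          x \in A -> x != 0 -> orth_to_prev X i x ->
          y \in B -> y != 0 -> orth_to_prev Y i y ->
          psi (X i) (Y i) <= psi x y].

(* The value does not depend on the run. *)
Definition psi_ (R : realType) (n : nat) (j : nat)
    (A B : {vspace 'cV[R]_n}) : R :=
  xget 0 [set s | exists X Y : nat -> 'cV[R]_n,
                    principal_vectors A B j X Y /\ s = psi (X j) (Y j)].

Definition irrational_subspaces (R : realType) (n d e j : nat) :
    set {vspace 'cV[R]_n} :=
  [set A | \dim A = d /\
           forall B, rational_subspaces R n e B -> (\dim (A :&: B) < j)%N].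
Arguments irrational_subspaces : clear implicits.

Definition mu (R : realType) (n : nat) (A : {vspace 'cV[R]_n}) (e j : nat) :
    \bar R :=
  ereal_sup [set beta%:E | beta in
    [set beta : R | 0 < beta /\
       infinite_set [set B | rational_subspaces R n e B /\
                             psi_ j A B <= height B `^ (- beta)]]].

Definition mu_ring (R : realType) (n d e j : nat) : \bar R :=
  ereal_inf [set mu A e j | A in irrational_subspaces R n d e j].

(* Main.v *)
Require Import Defs.
From mathcomp Require Import all_boot all_order all_algebra all_fingroup.
From mathcomp Require Import all_classical all_reals all_analysis.
From mathcomp Require Import ring lra zify.
Set Implicit Arguments.
Unset Strict Implicit.
Unset Printing Implicit Defensive.
Import Order.TTheory GRing.Theory Num.Theory.
Local Open Scope ring_scope.

(** A subspace A of dimension d has, once d independent coordinates are used as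
parameters, a basis in echelon form: each basis vector has at most n - d
entries that are not 0 or 1 ([echelon_vectors]).  Approximate the j * (n - d)
real entries of the first j basis vectors a_i by rationals with one common
denominator q: the pigeonhole principle ([dirichlet]) gives, for every Q, some
q <= Q ^ (j (n - d)) with error at most 1 / (q Q), hence roughly
q ^ (- 1 - 1 / (j (n - d))).  The approximating vectors b_i span a rational
subspace of dimension j whose height is O(q ^ j).

To pass from dimension j to dimension e, that subspace is enlarged so that the
height drops to O(q ^ (j (n - e) / (n - j))) ([rational_extension]).  This is
lattice reduction: start from a basis of Z^n whose first j vectors span the
same subspace, and exchange consecutive vectors beyond these as long as that
decreases the sum of the Gram determinants G_k of the prefixes.  When no
exchange helps any more, 3 G_(k+1)^2 <= 4 G_k G_(k+2) ([reduced_flag]): up to a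
constant k |-> ln G_k is convex between j and n, so, as G_n = 1, ln G_e lies
below the chord ([log_convex_chord]).  The height of the span of the first e
vectors is at most a constant times the square root of G_e ([height_bounds]).

If B contains all the b_i, then psi_j(A, B) = O(1 / (q Q))
([psi_close_le]).  Since B cannot contain all the a_i, a given B serves only
boundedly many Q, so infinitely many B arise ([not_mem_gap_seq]).  The
resulting exponent is

  (n - j) / (n - e) * (1 / j + 1 / (j^2 (n - d))),

while the claimed one is obtained by replacing the last n - d by the larger
n - d + j / 2 + 1 / 2.  The strict inequality absorbs all the constants. *)

(** * Gram determinants and minors *)

Definition gram (R : comNzRingType) n k (V : 'M[R]_(n, k)) : R :=
  \det (V^T *m V).

Lemma gram_mulmx (R : comNzRingType) n k (V : 'M[R]_(n, k)) (E : 'M[R]_k) :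
  gram (V *m E) = \det E ^+ 2 * gram V.
Proof.
rewrite /gram trmx_mul -mulmxA (mulmxA V^T) !det_mulmx det_tr.
by rewrite [\det _ * \det E]mulrC mulrA expr2.
Qed.

Lemma map_gram (R S : comNzRingType) (f : {rmorphism R -> S}) n k
  (V : 'M[R]_(n, k)) : gram (map_mx f V) = f (gram V).
Proof. by rewrite /gram -det_map_mx map_mxM map_trmx. Qed.

Lemma det_rowsub_perm (R : comNzRingType) n k (B : 'M[R]_(n, k))
  (f : {ffun 'I_k -> 'I_n}) (s : 'S_k) :
  \det (rowsub [ffun i => f (s i)] B) = (-1) ^+ s * \det (rowsub f B).
Proof.
have -> : rowsub [ffun i => f (s i)] B = row_perm s (rowsub f B).
  by apply/matrixP => a b; rewrite !mxE ffunE.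
by rewrite row_permE det_mulmx det_perm.
Qed.

(** Multilinearity in the rows of the first factor: the sum runs over all row
selections, the non-injective ones contributing 0. *)
Lemma det_mulmx_sum (R : comNzRingType) n k (A : 'M[R]_(k, n)) (B : 'M[R]_(n, k)) :
  \det (A *m B) =
  \sum_(f : {ffun 'I_k -> 'I_n}) (\prod_i A i (f i)) * \det (rowsub f B).
Proof.
rewrite /determinant.
transitivity (\sum_(s : 'S_k) \sum_(f : {ffun 'I_k -> 'I_n})
  (-1) ^+ s * \prod_i (A i (f i) * B (f i) (s i))).
  apply: eq_bigr => s _; rewrite -mulr_sumr; congr (_ * _).
  rewrite -(bigA_distr_bigA (fun i j => A i j * B j (s i))).
  by apply: eq_bigr => i _; rewrite mxE.
rewrite exchange_big; apply: eq_bigr => f _; rewrite mulr_sumr.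
apply: eq_bigr => s _; rewrite big_split mulrCA; congr (_ * (_ * _)).
by apply: eq_bigr => i _; rewrite mxE.
Qed.

(** A form of the Cauchy-Binet formula.  Averaging [det_mulmx_sum] over all
reorderings of the selected rows turns the product of entries into a second
minor; each increasing selection is thereby counted k! times. *)
Lemma gram_sum_minors (R : comNzRingType) n k (V : 'M[R]_(n, k)) :
  gram V *+ k`! = \sum_(f : {ffun 'I_k -> 'I_n}) \det (rowsub f V) ^+ 2.
Proof.
pose P (f : {ffun 'I_k -> 'I_n}) := \prod_i V (f i) i.
have E (s : 'S_k) : gram V =
    \sum_(f : {ffun 'I_k -> 'I_n})
      (-1) ^+ s * P [ffun i => f (s i)] * \det (rowsub f V).
  rewrite /gram det_mulmx_sum.
  rewrite (reindex_inj (h := fun f : {ffun 'I_k -> 'I_n} => [ffun i => f (s i)])).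
    apply: eq_bigr => f _; rewrite det_rowsub_perm mulrCA mulrA; congr (_ * _ * _).
    by apply: eq_bigr => i _; rewrite mxE.
  move=> f g /ffunP fg; apply/ffunP => i.
  by have := fg (s^-1%g i); rewrite !ffunE permKV.
have -> : gram V *+ k`! = \sum_(s : 'S_k) gram V.
  rewrite sumr_const; congr (_ *+ _).
  by rewrite card_Sn.
rewrite (eq_bigr _ (fun s _ => E s)) exchange_big; apply: eq_bigr => f _.
rewrite -mulr_suml expr2; congr (_ * _).
rewrite -det_tr; apply: eq_bigr => s _; congr (_ * _).
by apply: eq_bigr => i _; rewrite !mxE ffunE.
Qed.

Lemma gram_ge0 (R : realDomainType) n k (V : 'M[R]_(n, k)) : 0 <= gram V.
Proof.
rewrite -(pmulrn_lge0 _ (fact_gt0 k)) gram_sum_minors.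
by apply: sumr_ge0 => f _; exact: sqr_ge0.
Qed.

(** If c kills V^T V then c V^T has Euclidean norm 0. *)
Lemma gram_eq0 (R : realFieldType) n k (V : 'M[R]_(n, k)) :
  (gram V == 0) = ~~ row_free V^T.
Proof.
apply/idP/idP => [/det0P [v v0 vV]|].
  apply/negP => Vfree; move/negP: v0; apply.
  have vV0 : v *m V^T = 0.
    have : (v *m V^T *m (v *m V^T)^T) 0 0 = 0.
      by rewrite trmx_mul trmxK !mulmxA -(mulmxA v) vV mul0mx mxE.
    rewrite mxE => /eqP; rewrite psumr_eq0 => [/allP h|i _]; last first.
      by rewrite [X in _ * X]mxE -expr2 sqr_ge0.
    apply/rowP => i; rewrite [RHS]mxE; apply/eqP.
    by have := h i (mem_index_enum i); rewrite [X in _ * X]mxE -expr2 sqrf_eq0.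
  by apply/eqP; apply: (row_free_inj Vfree); rewrite vV0 mul0mx.
apply: contraNT => G0; rewrite -kermx_eq0; apply/eqP/row_matrixP => i.
have : kermx V^T *m (V^T *m V) = 0 by rewrite mulmxA mulmx_ker mul0mx.
have U : V^T *m V \in unitmx by rewrite unitmxE unitfE.
by move/(congr1 (mulmx^~ (invmx (V^T *m V)))); rewrite mulmxK // mul0mx => ->.
Qed.

Lemma gram_gt0 (R : realFieldType) n k (V : 'M[R]_(n, k)) :
  (0 < gram V) = row_free V^T.
Proof. by rewrite lt0r gram_ge0 andbT gram_eq0 negbK. Qed.

Lemma det_norm_le (R : numDomainType) k (S : 'M[R]_k) (c : R) :
  (forall a b, `|S a b| <= c) -> `|\det S| <= c ^+ k *+ k`!.
Proof.
move=> Sc; apply: (le_trans (ler_norm_sum _ _ _)).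
have -> : c ^+ k *+ k`! = \sum_(s : 'S_k) c ^+ k.
  by rewrite sumr_const card_Sn.
apply: ler_sum => s _; rewrite normrM normr_prod normrX normrN1 expr1n mul1r.
rewrite -[X in _ <= c ^+ X]card_ord -prodr_const.
by apply: ler_prod => i _; rewrite normr_ge0 Sc.
Qed.

Lemma gram_le (R : realDomainType) n k (V : 'M[R]_(n, k)) (c : R) :
  (forall a b, `|V a b| <= c) -> gram V <= (c ^+ 2 *+ n) ^+ k *+ k`!.
Proof.
move=> Vc; apply: (le_trans (ler_norm _)); apply: det_norm_le => a b.
rewrite mxE; apply: (le_trans (ler_norm_sum _ _ _)).
rewrite -[X in _ *+ X]card_ord -sumr_const.
apply: ler_sum => i _; rewrite normrM mxE expr2.
by apply: ler_pM.
Qed.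

(** The matrix P is the orthogonal projection onto the complement of the column
space of W, and the identity is the Schur complement formula. *)
Lemma gram_schur (R : realFieldType) n k (W : 'M[R]_(n, k)) : gram W != 0 ->
  exists2 P : 'M[R]_n, P^T = P &
    forall m (Z : 'M[R]_(n, m)), gram (row_mx W Z) = gram W * \det (Z^T *m P *m Z).
Proof.
move=> G0; set S := W^T *m W; have U : S \in unitmx by rewrite unitmxE unitfE.
have St : S^T = S by rewrite /S trmx_mul trmxK.
exists (1%:M - W *m invmx S *m W^T).
  by rewrite linearB /= trmx1 !trmx_mul trmxK trmx_inv St mulmxA.
move=> m Z; rewrite /gram tr_row_mx mul_col_row.
have -> : block_mx (W^T *m W) (W^T *m Z) (Z^T *m W) (Z^T *m Z) =
   block_mx 1%:M 0 (Z^T *m W *m invmx S) 1%:M *m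
   block_mx S (W^T *m Z) 0 (Z^T *m (1%:M - W *m invmx S *m W^T) *m Z).
  rewrite mulmx_block !mul1mx !mul0mx !addr0 mulmxKV //; congr block_mx.
  by rewrite mulmxBr mulmxBl mulmx1 !mulmxA addrC subrK.
by rewrite det_mulmx det_lblock det_ublock !det1 !mul1r.
Qed.

(** * Reduced flags of integral bases *)

Definition cols (R : nmodType) n (k : nat) (u : nat -> 'cV[R]_n) : 'M[R]_(n, k) :=
  \matrix_(r < n, a < k) u a r 0.

Lemma cols_cat (R : nmodType) n k m (u : nat -> 'cV[R]_n) :
  cols (k + m) u = row_mx (cols k u) (cols m (fun a => u (k + a)%N)).
Proof.
apply/matrixP => r a; rewrite !mxE.
by case: split_ordP => b ->; rewrite !mxE.
Qed.

Lemma eq_cols (R : nmodType) n k (u w : nat -> 'cV[R]_n) :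
  (forall a, (a < k)%N -> u a = w a) -> cols k u = cols k w.
Proof. by move=> uw; apply/matrixP => r a; rewrite !mxE uw. Qed.

Lemma map_cols (R S : nmodType) (f : R -> S) n k (u : nat -> 'cV[R]_n) :
  map_mx f (cols k u) = cols k (fun a => map_mx f (u a)).
Proof. by apply/matrixP => r a; rewrite !mxE. Qed.

Lemma cols_delta (R : pzRingType) n k (u : nat -> 'cV[R]_n) (a : 'I_k) :
  cols k u *m delta_mx a 0 = u a.
Proof. by rewrite -colE; apply/colP => r; rewrite !mxE. Qed.

(** Over the integers this is membership in the lattice generated by the first k
vectors of the sequence. *)
Definition column_comb (R : pzRingType) n k (u : nat -> 'cV[R]_n) (v : 'cV[R]_n) :=
  exists c, v = cols k u *m c.

Lemma column_comb_mem (R : pzRingType) n k (u : nat -> 'cV[R]_n) a :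
  (a < k)%N -> column_comb k u (u a).
Proof. by move=> ak; exists (delta_mx (Ordinal ak) 0); rewrite cols_delta. Qed.

Lemma column_combD (R : comPzRingType) n k (u : nat -> 'cV[R]_n) v w t :
  column_comb k u v -> column_comb k u w -> column_comb k u (v + t *: w).
Proof. by move=> [c ->] [d ->]; exists (c + t *: d); rewrite mulmxDr scalemxAr. Qed.

Lemma column_comb_cols (R : pzRingType) n k m (u w : nat -> 'cV[R]_n) :
  (forall a, (a < m)%N -> column_comb k u (w a)) -> exists E, cols m w = cols k u *m E.
Proof.
move=> h; have {h} h (a : 'I_m) : exists c : 'cV[R]_k, w a = cols k u *m c by exact: h.
have [c cP] := fin_all_exists h.
exists (\matrix_(b, a) c a b 0); apply/matrixP => r a; rewrite !mxE.
by rewrite cP mxE; apply: eq_bigr => b _; rewrite !mxE.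
Qed.

(** Passing to a sublattice multiplies the Gram determinant by the square of the
index, a positive integer. *)
Lemma gram_comb_le n k (u w : nat -> 'cV[int]_n) :
  (forall a, (a < k)%N -> column_comb k u (w a)) -> gram (cols k w) != 0 ->
  gram (cols k u) <= gram (cols k w).
Proof.
move=> /column_comb_cols[E ->]; rewrite gram_mulmx mulf_eq0 => /norP[E0 _].
by rewrite ler_peMl ?gram_ge0 // -gtz0_ge1 lt0r E0 sqr_ge0.
Qed.

Lemma gram_comb_eq n k (u w : nat -> 'cV[int]_n) :
  (forall a, (a < k)%N -> column_comb k u (w a)) ->
  (forall a, (a < k)%N -> column_comb k w (u a)) ->
  gram (cols k w) = gram (cols k u).
Proof.
move=> uw wu; have [u0|u0] := eqVneq (gram (cols k u)) 0.
  have [E ->] := column_comb_cols uw.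
  by rewrite gram_mulmx u0 mulr0.
have w0 : gram (cols k w) != 0.
  apply: contra_neq u0 => w0; have [E ->] := column_comb_cols wu.
  by rewrite gram_mulmx w0 mulr0.
by apply/eqP; rewrite eq_le !gram_comb_le.
Qed.

Lemma gram_prefix (R : realFieldType) n k m (u : nat -> 'cV[R]_n) :
  (k <= m)%N -> 0 < gram (cols m u) -> 0 < gram (cols k u).
Proof.
move=> km; rewrite !gram_gt0 -(subnKC km) cols_cat tr_row_mx -!kermx_eq0.
move=> K0; apply/eqP/row_matrixP => i; rewrite row0.
suff : row_mx (row i (kermx (cols k u)^T)) 0 = 0 :> 'rV_(k + (m - k)).
  by rewrite -[RHS]row_mx0 => /eq_row_mx[].
rewrite kermx_eq0 in K0; apply: (row_free_inj K0); rewrite mul0mx mul_row_col.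
by rewrite mul0mx addr0 -row_mul mulmx_ker row0.
Qed.

Lemma gram_prefix_int n k m (u : nat -> 'cV[int]_n) :
  (k <= m)%N -> 0 < gram (cols m u) -> 0 < gram (cols k u).
Proof.
move=> km; rewrite -2!(ltr0z rat) -!map_gram !map_cols; exact: gram_prefix.
Qed.

Lemma det_mx22 (R : comNzRingType) (M : 'M[R]_2) :
  \det M = M 0 0 * M 1 1 - M 0 1 * M 1 0.
Proof.
rewrite (expand_det_row _ 0) !big_ord_recl big_ord0 addr0 /cofactor !det_mx11 !mxE /=.
rewrite expr0 expr1 mul1r mulN1r mulrN.
congr (_ * M _ _ - M _ _ * M _ _); exact: val_inj.
Qed.

(** In the notation of quadratic forms: with a, c and b the squared norms and the
scalar product of u_k and u_(k+1), projected orthogonally to the first k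
vectors, the hypothesis says 4 (a c - b^2) < 3 a^2.  Choosing the integer t so
that |b / a + t| <= 1 / 2 makes the squared norm of the projection of
u_(k+1) + t u_k equal to (a c - b^2) / a + a (b / a + t)^2 < 3 a / 4 + a / 4. *)
Lemma gram_swap_rat n k (u : nat -> 'cV[rat]_n) :
  0 < gram (cols k.+1 u) ->
  gram (cols k u) * gram (cols k.+2 u) *+ 4 < gram (cols k.+1 u) ^+ 2 *+ 3 ->
  exists t : int, gram (row_mx (cols k u) (u k.+1 + t%:~R *: u k)) < gram (cols k.+1 u).
Proof.
move=> a0 H; have g0 := gram_prefix (leqnSn k) a0.
have [P Pt GP] := gram_schur (lt0r_neq0 g0).
set g := gram (cols k u) in g0 GP H *.
pose B (v w : 'cV[rat]_n) := (v^T *m P *m w) 0 0.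
have BC v w : B v w = B w v.
  transitivity ((v^T *m P *m w)^T 0 0); first by rewrite [RHS]mxE.
  by rewrite !trmx_mul trmxK Pt mulmxA.
have E1 v : gram (row_mx (cols k u) v) = g * B v v by rewrite GP /B det_mx11.
have e1 : gram (cols k.+1 u) = g * B (u k) (u k).
  rewrite -addn1 cols_cat -E1; congr (gram (row_mx _ _)).
  by apply/colP => r; rewrite mxE addn0.
have e2 : gram (cols k.+2 u) =
    g * (B (u k) (u k) * B (u k.+1) (u k.+1) - B (u k) (u k.+1) ^+ 2).
  rewrite -addn2 cols_cat GP det_mx22.
  set Z := cols 2 _.
  have EZ (a b : 'I_2) : (Z^T *m P *m Z) a b = B (u (k + a)%N) (u (k + b)%N).
    rewrite /B !mxE; apply: eq_bigr => r _; rewrite !mxE; congr (_ * _).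
    by apply: eq_bigr => s _; rewrite !mxE.
  rewrite !EZ /= addn0 addn1 [B (u k.+1) (u k)]BC expr2.
  by [].
set a := B (u k) (u k) in e1 e2; set c := B (u k.+1) (u k.+1) in e2.
set b := B (u k) (u k.+1) in e2.
have e3 t : B (u k.+1 + t *: u k) (u k.+1 + t *: u k) = c + 2 * b * t + a * t ^+ 2.
  have -> : B (u k.+1 + t *: u k) (u k.+1 + t *: u k) =
     B (u k.+1) (u k.+1) + t * B (u k) (u k.+1) + t * B (u k.+1) (u k)
      + t * t * B (u k) (u k).
    have tr : (u k.+1 + t *: u k)^T = (u k.+1)^T + t *: (u k)^T.
      by apply/matrixP => r s; rewrite !mxE.
    rewrite /B tr !mulmxDl !mulmxDr -!scalemxAl -!scalemxAr.
    have mxD (X Y : 'M[rat]_1) : (X + Y) 0 0 = X 0 0 + Y 0 0 by rewrite mxE.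
    have mxZ z (Y : 'M[rat]_1) : (z *: Y) 0 0 = z * Y 0 0 by rewrite mxE.
    by rewrite scalerA !(mxD, mxZ); ring.
  by rewrite [B (u k.+1) (u k)]BC -/a -/b -/c; ring.
have apos : 0 < a by move: a0; rewrite e1 pmulr_rgt0.
pose t := Num.floor (2^-1 - b / a).
exists t; rewrite E1 e1 e3 ltr_pM2l //.
have /andP[t1 t2] := floor_itv (2^-1 - b / a).
rewrite -/t intrD in t1 t2.
set x : rat := t%:~R in t1 t2 *.
pose s := b / a + x.
have bE : b = a * (s - x) by rewrite /s addrK mulrCA divff ?mulr1 // lt0r_neq0.
have s1 : s <= 2^-1 by rewrite /s; lra.
have s2 : - 2^-1 <= s by rewrite /s; lra.
have ss : s ^+ 2 <= 4^-1 by nra.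
rewrite -/g e1 e2 bE in H.
have {}H : (c - a * (s - x) ^+ 2) *+ 4 < a *+ 3.
  have ga : 0 < g ^+ 2 * a by rewrite mulr_gt0 ?exprn_gt0.
  by rewrite -(ltr_pM2l ga); move: H; congr (_ < _); ring.
rewrite bE; have : a * s ^+ 2 <= a * 4^-1 by rewrite ler_pM2l.
have -> : c + 2 * (a * (s - x)) * x + a * x ^+ 2 =
    (c - a * (s - x) ^+ 2) + a * s ^+ 2 by ring.
lra.
Qed.

Lemma gram_swap n k (u : nat -> 'cV[int]_n) :
  0 < gram (cols k.+1 u) ->
  gram (cols k u) * gram (cols k.+2 u) *+ 4 < gram (cols k.+1 u) ^+ 2 *+ 3 ->
  exists t : int, gram (row_mx (cols k u) (u k.+1 + t *: u k)) < gram (cols k.+1 u).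
Proof.
move=> a0 H; pose w a := map_mx (intr : int -> rat) (u a).
have E m : gram (cols m w) = (gram (cols m u))%:~R by rewrite -map_cols map_gram.
case: (@gram_swap_rat n k w).
- by rewrite E ltr0z.
- by rewrite !E -rmorphM -rmorphXn -!rmorphMn ltr_int.
move=> t; rewrite E -map_cols -map_mxZ -map_mxD -map_row_mx map_gram ltr_int.
by exists t.
Qed.

(** Exchanging u_k with the shortened u_(k+1) leaves the lattice generated by
each prefix unchanged, except for the prefix of length k + 1. *)
Lemma flag_exchange n j k (u : nat -> 'cV[int]_n) :
  (j <= k)%N -> (k.+1 < n)%N -> gram (cols n u) = 1 ->
  gram (cols k u) * gram (cols k.+2 u) *+ 4 < gram (cols k.+1 u) ^+ 2 *+ 3 ->
  exists w : nat -> 'cV[int]_n,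
   [/\ forall a, (a < j)%N -> w a = u a,
       forall m, m != k.+1 -> gram (cols m w) = gram (cols m u) &
       gram (cols k.+1 w) < gram (cols k.+1 u)].
Proof.
move=> jk kn u1 H.
have [|t tP] := gram_swap _ H.
  by apply: (@gram_prefix_int n _ n); rewrite ?u1 // ltnW.
pose w a := if a == k then u k.+1 + t *: u k else if a == k.+1 then u k else u a.
have wk : w k = u k.+1 + t *: u k by rewrite /w eqxx.
have wk1 : w k.+1 = u k by rewrite /w gtn_eqF // eqxx.
have wo a : a != k -> a != k.+1 -> w a = u a by rewrite /w => /negPf -> /negPf ->.
have wl a : (a < k)%N -> w a = u a.
  by move=> ak; apply: wo; rewrite neq_ltn ?ak // ltnW.
exists w; split => [a aj|m mk|]; first by apply: wl; exact: leq_trans aj jk.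
- have [mlek|] := leqP m k.
    congr gram; apply: eq_cols => a am; apply: wl.
    exact: leq_trans am mlek.
  move=> km'; have km : (k.+1 < m)%N by rewrite ltn_neqAle eq_sym mk.
  apply: gram_comb_eq => a am.
    have [->|ak] := eqVneq a k.
      by rewrite wk; apply: column_combD; apply: column_comb_mem.
    have [->|ak1] := eqVneq a k.+1; first by rewrite wk1; apply: column_comb_mem.
    by rewrite wo //; apply: column_comb_mem.
  have [->|ak] := eqVneq a k; first by rewrite -wk1; apply: column_comb_mem.
  have [->|ak1] := eqVneq a k.+1.
    have -> : u k.+1 = w k + (- t) *: w k.+1 by rewrite wk wk1 scaleNr addrK.
    by apply: column_combD; apply: column_comb_mem.
  by rewrite -wo //; apply: column_comb_mem.
- have -> : gram (cols k.+1 w) = gram (row_mx (cols k u) (u k.+1 + t *: u k)) => //.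
  rewrite -wk -addn1 cols_cat; congr (gram (row_mx _ _)).
    by apply: eq_cols.
  by apply/colP => r; rewrite mxE addn0.
Qed.

(** Exchanges strictly decrease a sum of natural numbers, so they come to an end;
this is the termination argument of lattice reduction. *)
Lemma reduced_flag n j (u : nat -> 'cV[int]_n) : gram (cols n u) = 1 ->
  exists w : nat -> 'cV[int]_n,
   [/\ forall a, (a < j)%N -> w a = u a,
       gram (cols n w) = 1 &
       forall k, (j <= k)%N -> (k.+1 < n)%N ->
        gram (cols k.+1 w) ^+ 2 *+ 3 <= gram (cols k w) * gram (cols k.+2 w) *+ 4].
Proof.
pose Phi (w : nat -> 'cV[int]_n) := (\sum_(m < n) `|gram (cols m w)|)%N.
have [N] := ubnP (Phi u); elim: N u => // N IH u PhiN u1.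
have [/existsP[k /andP[jk kn]]|] := boolP [exists k : 'I_n, (j <= k)%N &&
   ((k.+1 < n)%N && (gram (cols k u) * gram (cols k.+2 u) *+ 4
                       < gram (cols k.+1 u) ^+ 2 *+ 3))].
  have /andP[{}kn H] := kn.
  have [w [wj wm wk]] := flag_exchange jk kn u1 H.
  have [||v [vj v1 vP]] := IH w.
  - rewrite -ltnS; apply: leq_trans PhiN; rewrite ltnS.
    rewrite /Phi (bigD1 (Ordinal kn)) //= [X in (_ < X)%N](bigD1 (Ordinal kn)) //=.
    rewrite -addSn; apply: leq_add.
      by rewrite -ltz_nat !gez0_abs ?gram_ge0.
    by apply: leq_sum => i ik; rewrite wm //; apply: contra_neq ik => e; exact: val_inj.
  - by rewrite wm // gtn_eqF.
  exists v; split=> // a aj; by rewrite vj // wj.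
move=> /existsPn H; exists u; split => // k jk kn.
have := H (Ordinal (ltnW kn)); rewrite /= jk kn /=.
by rewrite -leNgt.
Qed.

(** * Convexity and the growth of Gram determinants *)

Lemma convex_seq_last (R : realFieldType) (h : nat -> R) N :
  (forall k, (k < N)%N -> 2 * h k.+1 <= h k + h k.+2) ->
  N.+1%:R * h N <= h 0 + N%:R * h N.+1.
Proof.
elim: N => [|N IH] H; first by rewrite mul1r mul0r addr0.
have IH1 := IH (fun k kN => H k (ltnW kN)).
have HN := H N (ltnSn N).
move: IH1; rewrite -(natr1 N.+1) -(natr1 N).
have N0 : 0 <= N%:R :> R by rewrite ler0n.
by nra.
Qed.

(** Discrete form of the fact that a convex function lies below its chords. *)
Lemma convex_seq_chord (R : realFieldType) (h : nat -> R) N :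
  (forall k, (k.+1 < N)%N -> 2 * h k.+1 <= h k + h k.+2) ->
  forall e, (e <= N)%N -> N%:R * h e <= (N%:R - e%:R) * h 0 + e%:R * h N.
Proof.
elim: N => [|N IH] H e; first by rewrite leqn0 => /eqP ->; rewrite subrr !mul0r addr0.
rewrite leq_eqVlt => /predU1P[->|]; first by rewrite subrr mul0r add0r.
rewrite ltnS => eN.
have IHe := IH (fun k kN => H k (ltnW kN)) e eN.
have L := convex_seq_last (fun k (kN : (k < N)%N) => H k kN).
have [N0|N0] := posnP N.
  by move: eN; rewrite N0 leqn0 => /eqP ->; rewrite subr0 mul0r addr0.
have N0' : 0 < N%:R :> R by rewrite ltr0n.
rewrite -(ler_pM2l N0') -(natr1 N).
have e0 : 0 <= e%:R :> R by rewrite ler0n.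
have := ler_wpM2l e0 L; rewrite -(natr1 N) => L'.
have N1 : 0 <= N%:R + 1 :> R by rewrite addr_ge0 // ltW.
have := ler_wpM2l N1 IHe => IHe'.
by lra.
Qed.

(** Adding (ln 4 / 2) k^2 to ln (G k) makes the sequence convex: its second
difference gains ln 4, which outweighs the defect ln 4 - ln 3. *)
Lemma log_convex_chord (R : realType) (G : nat -> R) n j e :
  (j < n)%N -> (j <= e <= n)%N -> (forall k, (k <= n)%N -> 0 < G k) -> G n = 1 ->
  (forall k, (j <= k)%N -> (k.+1 < n)%N -> G k.+1 ^+ 2 *+ 3 <= G k * G k.+2 *+ 4) ->
  G e <= expR (ln 4 * n%:R ^+ 2) * G j `^ ((n%:R - e%:R) / (n%:R - j%:R)).
Proof.
move=> jn /andP[je en] G0 Gn H.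
have l4 : 0 <= ln 4 :> R by apply: ln_ge0; lra.
pose h k := ln (G (j + k)%N) + ln 4 / 2 * (j + k)%:R ^+ 2.
have conv k : (k.+1 < n - j)%N -> 2 * h k.+1 <= h k + h k.+2.
  move=> kn; have := H (j + k)%N (leq_addr _ _).
  rewrite -addnS -addnS => /(_ ltac:(lia)) Hk.
  have p0 : 0 < G (j + k)%N by apply: G0; lia.
  have p1 : 0 < G (j + k.+1)%N by apply: G0; lia.
  have p2 : 0 < G (j + k.+2)%N by apply: G0; lia.
  have {}Hk : G (j + k.+1)%N ^+ 2 <= 4 * (G (j + k)%N * G (j + k.+2)%N).
    have := exprn_ge0 2 (ltW p1); lra.
  rewrite -ler_ln ?posrE ?mulr_gt0 ?exprn_gt0 // in Hk.
  rewrite lnXn // lnM ?posrE ?mulr_gt0 // lnM ?posrE // in Hk.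
  rewrite /h !addnS -!(natr1 (_ + _).+1) -!(natr1 (j + k)).
  by move: Hk; rewrite !addnS; lra.
have := convex_seq_chord conv (leq_sub2r j en).
rewrite /h !subnKC // ?(ltnW jn) // addn0 Gn ln1 add0r !natrB // ?(ltnW jn) //.
have nj : 0 < n%:R - j%:R :> R by rewrite subr_gt0 ltr_nat.
have je' : j%:R <= e%:R :> R by rewrite ler_nat.
have en' : e%:R <= n%:R :> R by rewrite ler_nat.
have j0 : 0 <= j%:R :> R by rewrite ler0n.
set a := ln (G e); set b := ln (G j); set N := n%:R in en' nj *.
set E := e%:R; set J := j%:R in j0 nj je' *.
rewrite -/E in en' je'.
move=> L; have {}L : a <= (N - E) / (N - J) * b + ln 4 * N ^+ 2.
  have K : (N - J) * ((N - E) / (N - J)) = N - E by rewrite mulrC divfK ?lt0r_neq0.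
  rewrite -(ler_pM2l nj) mulrDr mulrA K.
  have h1 : (N - E) * (ln 4 * J ^+ 2) <= (N - E) * (ln 4 * N ^+ 2).
    by apply: ler_wpM2l; [lra|apply: ler_wpM2l => //; nra].
  have h2 : 0 <= (N - J) * (ln 4 * N ^+ 2).
    by apply: mulr_ge0; [lra|apply: mulr_ge0 => //; nra].
  have h3 : 0 <= (N - J) * (ln 4 * E ^+ 2).
    by apply: mulr_ge0; [lra|apply: mulr_ge0 => //; nra].
  lra.
rewrite -ler_ln ?posrE ?mulr_gt0 ?expR_gt0 ?powR_gt0 ?G0 ?(ltnW jn) //.
rewrite lnM ?posrE ?expR_gt0 ?powR_gt0 ?G0 ?(ltnW jn) // expRK ln_powR.
by rewrite addrC.
Qed.

Lemma going_up (R : realType) n j e (u : nat -> 'cV[int]_n) :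
  (j < n)%N -> (j <= e <= n)%N -> gram (cols n u) = 1 ->
  exists w : nat -> 'cV[int]_n,
  [/\ cols j w = cols j u, gram (cols n w) = 1 &
    (gram (cols e w))%:~R <= expR (ln 4 * n%:R ^+ 2) *
       (gram (cols j u))%:~R `^ ((n%:R - e%:R) / (n%:R - j%:R)) :> R].
Proof.
move=> jn jen u1; have [w [wj w1 wP]] := reduced_flag j u1.
have E : cols j w = cols j u by exact: eq_cols.
exists w; split => //; rewrite -E.
apply: (@log_convex_chord R (fun k => (gram (cols k w))%:~R)) => //.
- by move=> k kn; rewrite ltr0z; apply: (gram_prefix_int kn); rewrite w1.
- by rewrite w1.
- move=> k jk kn; have := wP k jk kn.
  by rewrite -rmorphM -rmorphXn -!rmorphMn ler_int.
Qed.

(** With M = L D S in Smith normal form and L, S unimodular, the columns of L form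
a basis of Z^n whose first j vectors span the column space of M. *)
Lemma unimodular_saturation n j (M : 'M[int]_(n, j)) : (j <= n)%N -> gram M != 0 ->
  exists u : nat -> 'cV[int]_n,
  [/\ gram (cols n u) = 1, gram (cols j u) <= gram M &
      exists E, M = cols j u *m E].
Proof.
case: n M => [|n] M jn G0.
  exists (fun=> 0); case: j M jn G0 => // M _ _; rewrite /gram !det_mx00; split => //.
  by exists 0; apply/matrixP => -[].
have [L uL [S _ [d _ def_M]]] := int_Smith_normal_form M.
pose u a : 'cV[int]_n.+1 := col (inord a) L.
have un : cols n.+1 u = L by apply/matrixP => r a; rewrite !mxE inord_val.
have [E ME] : exists E, M = cols j u *m E.
  exists ((\matrix_(a, b) (d`_a *+ (a == b :> nat))) *m S).
  rewrite mulmxA def_M; congr (_ *m _).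
  apply/matrixP => r b; rewrite !mxE.
  rewrite (bigD1 (widen_ord jn b)) //= [RHS](bigD1 b) //= !mxE !eqxx.
  rewrite !big1 ?addr0.
  - by congr (L _ _ * _); apply: val_inj; rewrite /= inordK // (leq_trans _ jn).
  - move=> a ab; rewrite !mxE; case: eqP => [e|_]; last by rewrite mulr0.
    by rewrite (val_inj e) eqxx in ab.
  - move=> a ab; rewrite !mxE; case: eqP => [e|_]; last by rewrite mulr0.
    by rewrite (@val_inj _ _ _ a (widen_ord jn b) e) eqxx in ab.
exists u; split; last by exists E.
  rewrite un /gram det_mulmx det_tr -expr2.
  by move: uL; rewrite unitmxE => /orP[] /eqP ->.
move: G0; rewrite ME gram_mulmx mulf_eq0 => /norP[E0 _].
by rewrite ler_peMl ?gram_ge0 // -gtz0_ge1 lt0r E0 sqr_ge0.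
Qed.

(** * Heights of subspaces spanned by integral vectors *)

Definition column_span (R : realType) n k (V : 'M[R]_(n, k)) : {vspace 'cV[R]_n} :=
  <<[seq col a V | a <- enum 'I_k]>>%VS.

Lemma mem_column_span (R : realType) n k (V : 'M[R]_(n, k)) v :
  v \in column_span V <-> exists c, v = V *m c.
Proof.
have Vc (c : 'cV[R]_k) : V *m c = \sum_a c a 0 *: col a V.
  apply/colP => r; rewrite !mxE summxE; apply: eq_bigr => a _.
  by rewrite !mxE mulrC.
split => [|[c ->]]; last first.
  rewrite Vc; apply: memv_suml => a _; apply/memvZ/memv_span.
  by apply/map_f; rewrite mem_enum.
rewrite /column_span span_def big_map big_enum => /memv_sumP[vs vsP ->].
have {}vsP a : exists k, vs a = k *: col a V by exact/vlineP/vsP.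
have [c cP] := fin_all_exists vsP.
exists (\col_a c a); rewrite Vc; apply: eq_bigr => a _.
by rewrite mxE cP.
Qed.

Lemma dim_column_span (R : realType) n k (V : 'M[R]_(n, k)) :
  row_free V^T -> \dim (column_span V) = k.
Proof.
move=> Vfree; pose f : 'Hom('cV[R]_k, 'cV[R]_n) := linfun (mulmx V).
have -> : column_span V = limg f.
  apply/vspaceP => v; apply/idP/idP => [/mem_column_span[c ->]|/memv_imgP[c _ ->]].
    by apply/memv_imgP; exists c; rewrite ?memvf // lfunE.
  by apply/mem_column_span; exists c; rewrite lfunE.
have /eqP ker0 : lker f == 0%VS.
  apply/lker0P => c d; rewrite !lfunE /= => /(congr1 trmx); rewrite !trmx_mul.
  by move/(row_free_inj Vfree)/trmx_inj.
by rewrite limg_dim_eq ?ker0 ?capv0 // dimvf /dim /= muln1.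
Qed.

Lemma column_span_basis (R : realType) n k (V : 'M[R]_(n, k)) :
  row_free V^T -> basis_of (column_span V) [seq col a V | a <- enum 'I_k].
Proof.
move=> Vf; rewrite basisEdim; apply/andP; split; first exact: subvv.
by rewrite size_map size_enum_ord dim_column_span.
Qed.

Lemma increasing_sort n k (f : {ffun 'I_k -> 'I_n}) : injective f ->
  exists s : 'S_k, increasing [ffun i => f (s i)].
Proof.
move=> f_inj; pose leT (a b : 'I_n) := (a <= b)%N.
pose t := [tuple f i | i < k].
have /tuple_permP[p pE] : perm_eq (sort leT t) t by rewrite perm_sort.
have tot : total leT by move=> a b; exact: leq_total.
have tr : transitive leT by move=> a b c; exact: leq_trans.
have rf : reflexive leT by move=> a; exact: leqnn.
exists p; apply/forallP => i; apply/forallP => l; apply/implyP => il.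
rewrite !ffunE.
have nthE (m : 'I_k) : nth (f i) (sort leT t) m = f (p m).
  rewrite pE -tnth_nth tnth_mktuple; exact: tnth_mktuple.
have sz : size (sort leT t) = k by rewrite size_sort size_tuple.
have := sorted_leq_nth tr rf (f i) (sort_sorted tot t).
move=> /(_ i l); rewrite !inE sz !ltn_ord => /(_ isT isT (ltnW il)).
rewrite !nthE /leT leq_eqVlt => /predU1P[e|//].
by have := perm_inj (f_inj _ _ (val_inj e)) => e'; rewrite e' ltnn in il.
Qed.

Lemma det_rowsub_ninj (R : comNzRingType) n k (N : 'M[R]_(n, k))
  (f : {ffun 'I_k -> 'I_n}) : ~ injective f -> \det (rowsub f N) = 0.
Proof.
move=> ninj; have /injectivePn[a [b ab fab]] : ~~ injectiveb f by apply/injectiveP.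
by apply: (determinant_alternate ab) => i; rewrite !mxE fab.
Qed.

(** By [gram_sum_minors] some minor is non-zero; sorting its rows only changes the
sign. *)
Lemma increasing_minor n k (N : 'M[int]_(n, k)) : gram N != 0 ->
  exists2 f, increasing f & \det (rowsub f N) != 0.
Proof.
move=> G0; apply: contrapT => H; move/eqP: G0; apply.
suff : gram N *+ k`! == 0 by rewrite mulrn_eq0 gtn_eqF ?fact_gt0 //= => /eqP.
rewrite gram_sum_minors big1 // => f _; apply/eqP; rewrite sqrf_eq0.
have [f_inj|ninj] := pselect (injective f); last by rewrite det_rowsub_ninj.
have [s incs] := increasing_sort f_inj; apply/eqP; apply: contrapT => /eqP f0.
apply: H; exists [ffun i => f (s i)]; rewrite // det_rowsub_perm.
by rewrite mulf_neq0 // signr_eq0.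
Qed.

(** By Bezout, the integers m for which x m is an integer are stable under gcd. *)
Lemma big_gcdn_intr (R : realType) (I : finType) (P : pred I) (F : I -> int) (x : R) :
  (forall i, P i -> exists z : int, x * (F i)%:~R = z%:~R) ->
  exists z : int, x * ((\big[gcdn/0%N]_(i | P i) `|F i|%N)%:~R) = z%:~R.
Proof.
move=> H; pose K (m : nat) := exists z : int, x * (m : int)%:~R = z%:~R.
apply: (big_ind K).
- by exists 0; rewrite mulr0.
- move=> a b [z zP] [y yP]; have [u [v uv]] := Bezoutz a b.
  exists (u * z + v * y); have -> : Posz (gcdn a b) = gcdz a b by [].
  rewrite -uv !rmorphD !rmorphM /= -zP -yP; ring.
- move=> i /H[z zP]; exists (Num.sg (F i) * z).
  by rewrite abszEsg !rmorphM /= mulrCA zP.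
Qed.

Lemma int_norm_ge1 (R : realType) (z : int) : z != 0 -> 1 <= `|z%:~R : R|.
Proof. by move=> z0; rewrite -intr_norm ler1z -gtz0_ge1 normr_gt0. Qed.

(** The minors of N divided by their gcd form a primitive representative, so the
height is not the default value 0.  Any primitive representative Xi is a
multiple g of the vector of minors of N; since the coordinates of Xi have gcd 1,
1 / g is an integer and |g| <= 1. *)
Lemma height_bounds (R : realType) n k (B : {vspace 'cV[R]_n}) (N : 'M[int]_(n, k)) :
  \dim B = k -> B = column_span (map_mx intr N) -> gram N != 0 ->
  0 < height B <= Num.sqrt ((gram N)%:~R *+ k`!).
Proof.
move=> Bk; move: N; rewrite -{}Bk => N BN G0.
pose m (f : {ffun 'I_(\dim B) -> 'I_n}) : int := \det (rowsub f N).
have NR (f : {ffun 'I_(\dim B) -> 'I_n}) :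
    \det (rowsub f (map_mx (intr : int -> R) N)) = (m f)%:~R.
  by rewrite /m -det_map_mx map_mxsub.
pose hval (Xi : {ffun 'I_(\dim B) -> 'I_n} -> int) : R :=
  Num.sqrt (\sum_(f : {ffun 'I_(\dim B) -> 'I_n} | increasing f)
              ((Xi f)%:~R : R) ^+ 2).
have ex : exists Xi, @primitive_plucker R n B Xi.
  pose g := (\big[gcdn/0%N]_(f : {ffun 'I_(\dim B) -> 'I_n} | increasing f) `|m f|)%N.
  have gm f : increasing f -> (g%:Z %| m f)%Z.
    by move=> incf; rewrite dvdzE; apply: (biggcdn_inf f).
  have g0 : (0 < g)%N.
    rewrite lt0n; apply/negP => /eqP g0; have [f incf] := increasing_minor G0.
    by have := gm f incf; rewrite g0 dvd0z => ->.
  exists (fun f => (m f %/ g%:Z)%Z); split.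
    exists (map_mx intr N), (g%:R^-1); split.
    - rewrite /basis_matrix {1}BN; apply: column_span_basis.
      by rewrite -gram_gt0 map_gram ltr0z lt0r G0 gram_ge0.
    - by rewrite invr_eq0 pnatr_eq0 -lt0n.
    - move=> f incf; rewrite NR -[in RHS](divzK (gm f incf)) rmorphM /= mulrCA.
      by rewrite mulVf ?mulr1 // pnatr_eq0 -lt0n.
  apply/eqP; rewrite -(eqn_pmul2r g0) mul1n {2}/g; apply/eqP.
  rewrite (big_morph (fun x => x * g)%N (fun x y => muln_gcdl x y g) (mul0n g)).
  apply: eq_bigr => f incf.
  by rewrite -{2}(divzK (gm f incf)) abszM.
have bnd Xi : @primitive_plucker R n B Xi ->
    0 < hval Xi <= Num.sqrt ((gram N)%:~R *+ (\dim B)`!).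
  move=> [[M [c [basM c0 XiE]] Xi1]].
  have [T MT] : exists T, M = map_mx intr N *m T.
    have colM b : exists t : 'cV[R]_(\dim B), col b M = map_mx intr N *m t.
      apply/mem_column_span; rewrite -BN.
      have : col b M \in <<[seq col a M | a <- enum 'I_(\dim B)]>>%VS.
        by apply/memv_span/map_f; rewrite mem_enum.
      by rewrite (span_basis basM).
    have [t tP] := fin_all_exists colM.
    exists (\matrix_(a, b) t b a 0); apply/matrixP => r b.
    have /matrixP/(_ r 0) := tP b; rewrite mxE => ->; rewrite !mxE.
    by apply: eq_bigr => a _; rewrite !mxE.
  have XiE' f : increasing f -> (Xi f)%:~R = (c * \det T) * (m f)%:~R :> R.
    move=> incf; rewrite XiE // MT -mul_rowsub_mx det_mulmx NR; ring.
  have gam0 : c * \det T != 0.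
    apply/eqP => e0; move: Xi1; rewrite big1 // => f incf; apply/eqP.
    by rewrite absz_eq0 -(intr_eq0 R) XiE' // e0 mul0r.
  have [|z] := @big_gcdn_intr R _ (@increasing n (\dim B)) Xi (c * \det T)^-1.
    by move=> f incf; exists (m f); rewrite XiE' // mulKf.
  rewrite Xi1 mulr1 => zE.
  have gam1 : (c * \det T) ^+ 2 <= 1.
    have z0 : z != 0 by rewrite -(intr_eq0 R) -zE invr_eq0.
    have := int_norm_ge1 R z0; rewrite -zE normfV -[X in _ <= X]mul1r.
    rewrite ler_pdivlMr ?normr_gt0 // mul1r => h.
    by rewrite -real_normK ?num_real // expr_le1.
  rewrite /hval; apply/andP; split.
    have [f incf Xf0] : exists2 f, increasing f & Xi f != 0.
      apply: contrapT => H; move: Xi1; rewrite big1 // => f incf; apply/eqP.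
      rewrite absz_eq0; apply/negPn/negP => Xf; apply: H; by exists f.
    rewrite sqrtr_gt0 (bigD1 f) //= ltr_pwDl ?sumr_ge0 //.
    - by rewrite exprn_even_gt0 //= intr_eq0.
    - by move=> i _; rewrite sqr_ge0.
  rewrite ler_sqrt; last by rewrite mulrn_wge0 // ler0z gram_ge0.
  rewrite -rmorphMn gram_sum_minors rmorph_sum /= [leRHS](bigID (@increasing n (\dim B))) /=.
  rewrite -[leLHS]addr0 lerD //; last first.
    by apply: sumr_ge0 => f _; rewrite rmorphXn sqr_ge0.
  apply: ler_sum => f incf; rewrite XiE' // exprMn rmorphXn /=.
  by rewrite ler_piMl ?sqr_ge0.
have [Xi XiP] := ex.
have := @xgetPex _ 0 [set h : R | exists2 Xi, @primitive_plucker R n B Xi & h = hval Xi].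
case; first by exists (hval Xi), Xi.
move=> Xi' Xi'P hE; rewrite /height; rewrite [xget _ _]hE; exact: bnd.
Qed.

(** * Principal vectors and the angle to nearby subspaces *)

Section Euclid.
Context {R : realType} {n : nat}.
Implicit Types x y z : 'cV[R]_n.

Lemma dotvC x y : dotv x y = dotv y x.
Proof. by apply: eq_bigr => i _; rewrite mulrC. Qed.

Lemma dotvDl x y z : dotv (x + y) z = dotv x z + dotv y z.
Proof. by rewrite -big_split; apply: eq_bigr => i _; rewrite mxE mulrDl. Qed.

Lemma dotvZl c x z : dotv (c *: x) z = c * dotv x z.
Proof. by rewrite mulr_sumr; apply: eq_bigr => i _; rewrite mxE mulrA. Qed.

Lemma dotvDr x y z : dotv x (y + z) = dotv x y + dotv x z.
Proof. by rewrite ![dotv x _]dotvC dotvDl. Qed.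

Lemma dotvZr c x z : dotv x (c *: z) = c * dotv x z.
Proof. by rewrite ![dotv x _]dotvC dotvZl. Qed.

Lemma dotvNl x z : dotv (- x) z = - dotv x z.
Proof. by rewrite -scaleN1r dotvZl mulN1r. Qed.

Lemma dotv0l z : dotv 0 z = 0.
Proof. by rewrite -(scale0r 0) dotvZl mul0r. Qed.

Lemma dotv_suml (I : Type) (r : seq I) (P : pred I) (F : I -> 'cV[R]_n) z :
  dotv (\sum_(i <- r | P i) F i) z = \sum_(i <- r | P i) dotv (F i) z.
Proof.
exact: (big_morph (fun v => dotv v z) (fun x y => dotvDl x y z) (dotv0l z)).
Qed.

Lemma dotv_ge0 x : 0 <= dotv x x.
Proof. by apply: sumr_ge0 => i _; rewrite -expr2 sqr_ge0. Qed.

Lemma enormE x : enorm x = Num.sqrt (dotv x x).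
Proof. by rewrite /enorm /dotv; under eq_bigr do rewrite expr2. Qed.

Lemma enorm_ge0 x : 0 <= enorm x. Proof. exact: sqrtr_ge0. Qed.

Lemma sqr_enorm x : enorm x ^+ 2 = dotv x x.
Proof. by rewrite enormE sqr_sqrtr // dotv_ge0. Qed.

Lemma coord_le_enorm x i : `|x i 0| <= enorm x.
Proof.
rewrite -(@ler_pXn2r _ 2) ?nnegrE ?enorm_ge0 // sqr_enorm real_normK ?num_real //.
rewrite /dotv (bigD1 i) //= -expr2 lerDl.
by apply: sumr_ge0 => k _; rewrite -expr2 sqr_ge0.
Qed.

Lemma enorm_gt0 x : (0 < enorm x) = (x != 0).
Proof.
apply/idP/idP => [|x0].
  by apply: contraTneq => ->; rewrite enormE dotv0l sqrtr0 ltxx.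
have [i xi] : exists i, x i 0 != 0.
  apply: contrapT => H; move/eqP: x0; apply; apply/colP => i; rewrite mxE.
  by apply/eqP/negPn/negP => xi; apply: H; exists i.
by apply: lt_le_trans (coord_le_enorm x i); rewrite normr_gt0.
Qed.

(** The sum over ordered pairs of indices is twice the sum over increasing ones. *)
Lemma lagrange_identity x y :
  wedge_norm x y ^+ 2 = dotv x x * dotv y y - dotv x y ^+ 2.
Proof.
rewrite sqr_sqrtr; last by apply: sumr_ge0 => i _; apply: sumr_ge0 => k _; rewrite sqr_ge0.
pose F (i k : 'I_n) := (x i 0 * y k 0 - x k 0 * y i 0) ^+ 2.
pose S := \sum_(i < n) \sum_(k < n | (i < k)%N) F i k.
have FC i k : F i k = F k i by rewrite /F; ring.
have full : \sum_(i < n) \sum_(k < n) F i k = S *+ 2.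
  have -> : \sum_(i < n) \sum_(k < n) F i k =
      S + \sum_(i < n) \sum_(k < n | (k < i)%N) F i k.
    rewrite -big_split; apply: eq_bigr => i _ /=.
    rewrite (bigID (fun k : 'I_n => (i < k)%N)) /=; congr (_ + _).
    rewrite (bigD1 i) ?ltnn //= {1}/F subrr expr0n add0r.
    by apply: eq_bigl => k; rewrite -leqNgt ltn_neqAle andbC.
  rewrite mulr2n; congr (_ + _); rewrite (exchange_big_dep xpredT) //=.
  by apply: eq_bigr => i _; apply: eq_bigr => k _.
suff : S *+ 2 = (dotv x x * dotv y y - dotv x y ^+ 2) *+ 2.
  by rewrite -/S; lra.
rewrite -full.
have -> : (dotv x x * dotv y y - dotv x y ^+ 2) *+ 2 =
  dotv x x * dotv y y + dotv y y * dotv x x - (dotv x y * dotv x y) *+ 2 by ring.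
rewrite /dotv !big_distrlr -sumrMnl -big_split -sumrB; apply: eq_bigr => i _ /=.
rewrite -sumrMnl -big_split -sumrB; apply: eq_bigr => k _ /=.
by rewrite /F; ring.
Qed.

Lemma wedge_norm_ge0 x y : 0 <= wedge_norm x y. Proof. exact: sqrtr_ge0. Qed.

Lemma wedge_norm_le x y : wedge_norm x y <= enorm x * enorm y.
Proof.
rewrite -(@ler_pXn2r _ 2) ?nnegrE ?mulr_ge0 ?enorm_ge0 ?wedge_norm_ge0 //.
by rewrite exprMn !sqr_enorm lagrange_identity lerBlDr lerDl sqr_ge0.
Qed.

Lemma wedge_norm_subr x y : wedge_norm (x - y) y = wedge_norm x y.
Proof.
rewrite /wedge_norm; congr Num.sqrt; apply: eq_bigr => i _; apply: eq_bigr => k _.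
by rewrite !mxE; ring.
Qed.

Lemma dotv_le x y : `|dotv x y| <= enorm x * enorm y.
Proof.
rewrite -(@ler_pXn2r _ 2) ?nnegrE ?mulr_ge0 ?enorm_ge0 //.
rewrite real_normK ?num_real // exprMn !sqr_enorm -subr_ge0 -lagrange_identity.
exact: sqr_ge0.
Qed.

Lemma enormD x y : enorm (x + y) <= enorm x + enorm y.
Proof.
rewrite -(@ler_pXn2r _ 2) ?nnegrE ?addr_ge0 ?enorm_ge0 //.
rewrite sqrrD !sqr_enorm dotvDl !dotvDr [dotv y x]dotvC.
have := le_trans (ler_norm _) (dotv_le x y); lra.
Qed.

Lemma enormZ c x : enorm (c *: x) = `|c| * enorm x.
Proof.
by rewrite !enormE dotvZl dotvZr mulrA -expr2 sqrtrM ?sqr_ge0 // sqrtr_sqr.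
Qed.

Lemma enorm0 : enorm (0 : 'cV[R]_n) = 0.
Proof. by rewrite enormE dotv0l sqrtr0. Qed.

Lemma enorm_sum (I : Type) (r : seq I) (P : pred I) (F : I -> 'cV[R]_n) :
  enorm (\sum_(i <- r | P i) F i) <= \sum_(i <- r | P i) enorm (F i).
Proof.
apply: (big_ind2 (fun v s => enorm v <= s)); first by rewrite enorm0.
  by move=> x s y t xs yt; apply: le_trans (enormD _ _) (lerD xs yt).
by [].
Qed.

Lemma enorm_le x c : (forall i, `|x i 0| <= c) -> enorm x <= c *+ n.
Proof.
move=> xc; have -> : x = \sum_i x i 0 *: delta_mx i 0.
  by rewrite {1}[x]matrix_sum_delta; apply: eq_bigr => i _; rewrite big_ord1.
apply: le_trans (enorm_sum _ _ _) _; rewrite -[X in _ *+ X]card_ord -sumr_const.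
apply: ler_sum => i _; rewrite enormZ.
suff -> : enorm (delta_mx i 0 : 'cV[R]_n) = 1 by rewrite mulr1.
rewrite enormE /dotv (bigD1 i) //= big1 ?addr0 => [|k ki].
  by rewrite !mxE !eqxx mulr1 sqrtr1.
by rewrite !mxE (negPf ki) mulr0.
Qed.

Lemma psi_ge0 x y : 0 <= psi x y.
Proof. by rewrite divr_ge0 ?mulr_ge0 ?enorm_ge0 ?wedge_norm_ge0. Qed.

Lemma sqr_psi x y : x != 0 -> y != 0 ->
  psi x y ^+ 2 = 1 - dotv x y ^+ 2 / (dotv x x * dotv y y).
Proof.
rewrite -!enorm_gt0 => x0 y0.
rewrite exprMn lagrange_identity exprVn exprMn !sqr_enorm mulrBl divff //.
by rewrite -!sqr_enorm mulf_neq0 // sqrf_eq0 gt_eqF.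
Qed.

(** Subtracting y from x does not change the bivector x /\ y. *)
Lemma psi_le_sub x y : x != 0 -> y != 0 -> psi x y <= enorm (x - y) / enorm x.
Proof.
rewrite -!enorm_gt0 => x0 y0; rewrite /psi -wedge_norm_subr invfM mulrA mulrAC.
by rewrite ler_pM2r ?invr_gt0 // ler_pdivrMr // wedge_norm_le.
Qed.

End Euclid.

(** First-order condition at a minimum.  Let a = X_i . Y_i, b = X_i . z and
s = z . z.  Among the combinations of Y_i and z, the one closest in direction
to X_i is s a Y_i + b z; its squared cosine with X_i is a^2 + b^2 / s, which by
minimality does not exceed a^2. *)
Lemma principal_orth (R : realType) n (A B : {vspace 'cV[R]_n}) j X Y i z :
  principal_vectors A B j X Y -> (1 <= i <= j)%N -> z \in B ->
  orth_to_prev Y i.+1 z -> dotv z (X i) = 0.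
Proof.
move=> pv ij zB zY; have [[XA X1 XX] [YB Y1 YY] mini] := pv i ij.
apply: contrapT => /eqP b0; set b := dotv z (X i) in b0.
have z0 : z != 0 by apply: contraNneq b0 => z0; rewrite /b z0 dotv0l.
set a := dotv (X i) (Y i); set s := dotv z z.
have s0 : 0 < s by rewrite /s -sqr_enorm exprn_gt0 // enorm_gt0.
have X2 : dotv (X i) (X i) = 1 by rewrite -sqr_enorm X1 expr1n.
have Y2 : dotv (Y i) (Y i) = 1 by rewrite -sqr_enorm Y1 expr1n.
have zYi : dotv z (Y i) = 0 by apply: zY; case/andP: ij => ->; rewrite ltnSn.
have X0 : X i != 0 by rewrite -enorm_gt0 X1.
have Y0 : Y i != 0 by rewrite -enorm_gt0 Y1.
pose t := s * a ^+ 2 + b ^+ 2.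
have b2 : 0 < b ^+ 2 by rewrite exprn_even_gt0.
have t0 : 0 < t by rewrite ltr_wpDl // mulr_ge0 ?sqr_ge0 // ltW.
pose y := (s * a) *: Y i + b *: z.
have yy : dotv y y = s * t.
  rewrite /y !dotvDl !dotvDr !dotvZl !dotvZr Y2 [dotv (Y i) z]dotvC zYi -/s /t; ring.
have Xy : dotv (X i) y = t.
  by rewrite /y dotvDr !dotvZr -/a [dotv _ z]dotvC -/b /t; ring.
have y0 : y != 0 by rewrite -enorm_gt0 enormE sqrtr_gt0 yy mulr_gt0.
have := mini (X i) y XA X0 XX.
have yB : y \in B by apply: memvD; apply: memvZ.
have yorth : orth_to_prev Y i y.
  move=> k /andP[k1 ki]; rewrite /y dotvDl !dotvZl YY ?k1 // zY ?k1 ?ltnS ?(ltnW ki) //.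
  by rewrite !mulr0 addr0.
move=> /(_ yB y0 yorth).
rewrite -(@ler_pXn2r _ 2) ?nnegrE ?psi_ge0 // !sqr_psi // X2 Y2 yy Xy -/a.
rewrite !mul1r divr1 lerD2l lerN2 expr2 -mulf_div divff ?gt_eqF // mulr1.
rewrite ler_pdivrMr // /t; lra.
Qed.

Lemma principal_orthonormal (R : realType) n (A B : {vspace 'cV[R]_n}) j X Y i k :
  principal_vectors A B j X Y -> (1 <= i <= j)%N -> (1 <= k <= j)%N ->
  dotv (X i) (X k) = (i == k)%:R.
Proof.
move=> pv ij kj; have [[_ Xi oi] _ _] := pv i ij; have [[_ Xk ok] _ _] := pv k kj.
case: (ltngtP i k) => [ik|ki|<-].
- by rewrite dotvC ok // ik; case/andP: ij => ->.
- by rewrite oi // ki; case/andP: kj => ->.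
- by rewrite -sqr_enorm Xi expr1n.
Qed.

(** Let y be a non-zero combination of the j vectors b_i orthogonal to the j - 1
vectors Y_1, ..., Y_(j-1).  By [principal_orth] it is also orthogonal to
X_1, ..., X_(j-1).  The same combination of the a_i is close to y, hence almost
orthogonal to the X_k; subtracting its components along the X_k gives an
admissible x close to y, and psi(X_j, Y_j) <= psi(x, y) by minimality.  The
normalization of the b_i bounds the coefficients of y by its norm. *)
Lemma psi_principal_le (R : realType) n (A B : {vspace 'cV[R]_n}) j X Y
  (a b : 'I_j -> 'cV[R]_n) (f : 'I_j -> 'I_n) (eps : R) :
  principal_vectors A B j X Y -> (0 < j)%N ->
  (forall i, a i \in A) -> (forall i, b i \in B) ->
  (forall i k, b i (f k) 0 = (i == k)%:R) ->
  (forall i r, `|a i r 0 - b i r 0| <= eps) ->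
  (j ^ 2 * n)%:R * eps <= 2^-1 ->
  psi (X j) (Y j) <= 2 * (j ^ 2 * n)%:R * eps.
Proof.
case: j a b f => // j a b f pv _ aA bB bf ab eps2.
have jj : (1 <= j.+1 <= j.+1)%N by rewrite leqnn.
have [_ _ mini] := pv _ jj.
pose D : 'M[R]_(j.+1, j) := \matrix_(i, k) dotv (b i) (Y k.+1).
have [c c0 cD] : exists2 c : 'rV[R]_j.+1, c != 0 & c *m D = 0.
  exists (nz_row (kermx D)).
    rewrite nz_row_eq0 kermx_eq0 /row_free neq_ltn; apply/orP; left.
    by rewrite ltnS; apply: rank_leq_col.
  by apply/sub_kermxP; apply: nz_row_sub.
pose y := \sum_i c 0 i *: b i; pose x0 := \sum_i c 0 i *: a i.
have yf k : y (f k) 0 = c 0 k.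
  rewrite summxE (bigD1 k) //= !mxE bf eqxx mulr1 big1 ?addr0 // => i ik.
  by rewrite mxE bf (negPf ik) mulr0.
have yB : y \in B by apply: memv_suml => i _; apply: memvZ.
have x0A : x0 \in A by apply: memv_suml => i _; apply: memvZ.
have yY k : (1 <= k <= j)%N -> dotv y (Y k) = 0.
  case: k => // k /= kj; have /rowP/(_ (Ordinal kj)) := cD.
  rewrite !mxE => <-; rewrite dotv_suml; apply: eq_bigr => i _.
  by rewrite dotvZl mxE.
have y0 : y != 0.
  apply: contraNneq c0 => y0; apply/eqP/rowP => k.
  by rewrite -yf y0 !mxE.
have ny0 : 0 < enorm y by rewrite enorm_gt0.
have yX k : (1 <= k <= j)%N -> dotv y (X k) = 0.
  move=> /andP[k1 kj]; apply: (principal_orth pv) => //.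
    by rewrite k1 leqW.
  by move=> l /andP[l1 lk]; apply: yY; rewrite l1 -ltnS (leq_trans lk).
have eps0 : 0 <= eps by apply: le_trans (ab ord0 (f ord0)).
pose K : R := (j.+1 ^ 2 * n)%:R.
(* Orthogonality to the X_k is restored with x0 - y in place of x0, because y is
   orthogonal to them; this keeps the correction small. *)
pose x := x0 - \sum_(k < j) dotv (x0 - y) (X k.+1) *: X k.+1.
have xA : x \in A.
  apply: memvB => //; apply: memv_suml => k _; apply: memvZ.
  by have [|[]] := pv k.+1; rewrite // ltnS leqW // ltn_ord.
have xX : orth_to_prev X j.+1 x.
  move=> k /andP[k1 kj].
  have kj' : (1 <= k <= j)%N by rewrite k1 -ltnS.
  rewrite /x dotvDl dotvNl [dotv (\sum_(l < j) _) _]dotv_suml.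
  case: k k1 kj kj' => // k _ kj kj'.
  have kX : (1 <= k.+1 <= j.+1)%N by exact: leqW kj'.
  rewrite (bigD1 (Ordinal kj')) //= big1 => [|l lk].
    rewrite dotvZl (principal_orthonormal pv) // eqxx mulr1 addr0.
    by rewrite dotvDl dotvNl yX // subr0 subrr.
  rewrite dotvZl (principal_orthonormal pv) //.
    by rewrite eqSS; move: lk; rewrite -val_eqE /= => /negPf ->; rewrite mulr0.
  by rewrite ltnS leqW // ltn_ord.
have d0 : enorm (x0 - y) <= (j.+1 * n)%:R * eps * enorm y.
  have e1 : enorm (x0 - y) <= (j.+1%:R * (enorm y * eps)) *+ n.
    apply: enorm_le => r; rewrite -sumrB summxE.
    apply: (le_trans (ler_norm_sum _ _ _)).
    have -> : j.+1%:R * (enorm y * eps) = \sum_(i < j.+1) enorm y * eps.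
      by rewrite sumr_const card_ord mulr_natl.
    apply: ler_sum => i _; rewrite -scalerBr !mxE normrM.
    by apply: ler_pM => //; rewrite -yf; exact: coord_le_enorm.
  apply: (le_trans e1); rewrite natrM -mulr_natr.
  by rewrite le_eqVlt; apply/orP; left; apply/eqP; ring.
have d1 : enorm (x - y) <= K * eps * enorm y.
  have -> : x - y = (x0 - y) + \sum_(k < j) (- dotv (x0 - y) (X k.+1)) *: X k.+1.
    rewrite /x addrAC; congr (_ + _); rewrite -sumrN.
    by apply: eq_bigr => k _; rewrite scaleNr.
  apply: (le_trans (enormD _ _)).
  have : enorm (\sum_(k < j) (- dotv (x0 - y) (X k.+1)) *: X k.+1) <=
      \sum_(k < j) enorm (x0 - y).
    apply: (le_trans (enorm_sum _ _ _)); apply: ler_sum => k _.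
    have [|[_ X1 _] _ _] := pv k.+1; first by rewrite // ltnS leqW // ltn_ord.
    rewrite enormZ X1 mulr1 normrN; apply: le_trans (dotv_le _ _) _.
    by rewrite X1 mulr1.
  rewrite sumr_const card_ord => h.
  apply: (@le_trans _ _ (j.+1%:R * enorm (x0 - y))).
    by rewrite -natr1 mulrDl mul1r mulr_natl addrC lerD2r.
  have := ler_wpM2l (ler0n R j.+1) d0.
  by rewrite /K expnS expn1 !natrM !mulrA.
have nx : enorm y <= 2 * enorm x.
  have := enormD x (y - x); rewrite addrC subrK.
  have -> : enorm (y - x) = enorm (x - y) by rewrite -opprB -scaleN1r enormZ normrN1 mul1r.
  have : K * eps * enorm y <= 2^-1 * enorm y by rewrite ler_pM2r.
  by lra.
have nx0 : 0 < enorm x by lra.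
have x_neq0 : x != 0 by rewrite -enorm_gt0.
apply: (le_trans (mini x y xA x_neq0 xX yB y0 _)).
  by move=> k /andP[k1 kj]; apply: yY; rewrite k1 -ltnS.
apply: (le_trans (psi_le_sub x_neq0 y0)).
rewrite ler_pdivrMr // (le_trans d1) // -/K.
have Ke : 0 <= K * eps by rewrite mulr_ge0.
by have := ler_wpM2l Ke nx; lra.
Qed.

(** If there is no run of the recursive choice, psi_ takes the default value 0. *)
Lemma psi_close_le (R : realType) n (A B : {vspace 'cV[R]_n}) j
  (a b : 'I_j -> 'cV[R]_n) (f : 'I_j -> 'I_n) (eps : R) : (0 < j)%N ->
  (forall i, a i \in A) -> (forall i, b i \in B) ->
  (forall i k, b i (f k) 0 = (i == k)%:R) ->
  (forall i r, `|a i r 0 - b i r 0| <= eps) ->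
  (j ^ 2 * n)%:R * eps <= 2^-1 ->
  psi_ j A B <= 2 * (j ^ 2 * n)%:R * eps.
Proof.
move=> j0 aA bB bf ab eps2; rewrite /psi_; case: xgetP => [s _ [X [Y [pv ->]]]|_].
  exact: (psi_principal_le pv j0 aA bB bf ab eps2).
case: j j0 a b f aA bB bf ab eps2 => // j _ a b f _ _ _ ab _.
by rewrite mulr_ge0 // (le_trans _ (ab ord0 (f ord0))).
Qed.

(** * Rational approximation of a subspace *)

(** Among Q ^ #|T| + 1 multiples of theta, two have fractional parts in the same
cube of side 1 / Q. *)
Lemma dirichlet (R : realType) (T : finType) (theta : T -> R) (Q : nat) :
  (0 < Q)%N ->
  exists (q : nat) (p : T -> int), (0 < q <= Q ^ #|T|)%N /\
    forall t, `|q%:R * theta t - (p t)%:~R| <= Q%:R^-1.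
Proof.
case: Q => // Q _.
pose fl k t := Num.floor (k%:R * theta t).
pose fr k t := k%:R * theta t - (fl k t)%:~R.
have frP k t : 0 <= fr k t < 1.
  have /andP[h1 h2] := floor_itv (k%:R * theta t); rewrite intrD in h2.
  by rewrite /fr /fl; lra.
pose box k t := Num.floor (Q.+1%:R * fr k t).
have Q0 : 0 < Q.+1%:R :> R by rewrite ltr0n.
have boxP k t : (0 <= box k t < Q.+1%:Z)%R.
  have /andP[h1 h2] := frP k t.
  by rewrite floor_ge_int floor_lt_int mulr_ge0 ?ler0n //= -pmulrn gtr_pMr.
pose g (k : 'I_(Q.+1 ^ #|T|).+1) : {ffun T -> 'I_Q.+1} :=
  [ffun t => inord `|box k t|%N].
have /injectivePn[k [l kl gkl]] : ~~ injectiveb g.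
  apply/negP => /injectiveP/leq_card; rewrite card_ord card_ffun card_ord.
  by rewrite ltnn.
wlog ltkl : k l kl gkl / (k < l)%N.
  move=> W; case: (ltngtP k l) => [kl'|lk|e]; first exact: (W k l).
    by apply: (W l k) => //; rewrite eq_sym.
  by move: kl; rewrite (val_inj e) eqxx.
exists (l - k)%N, (fun t => fl l t - fl k t); split.
  rewrite subn_gt0 ltkl /= (leq_trans (leq_subr _ _)) //.
  by rewrite -ltnS ltn_ord.
move=> t; have bkl : box k t = box l t.
  have /ffunP/(_ t)/(congr1 val) := gkl; rewrite !ffunE /=.
  have /andP[k0 k1] := boxP k t; have /andP[l0 l1] := boxP l t.
  rewrite !inordK; try by rewrite -ltz_nat gez0_abs.
  by move=> /(congr1 Posz); rewrite !gez0_abs.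
have -> : (l - k)%:R * theta t - (fl l t - fl k t)%:~R = fr l t - fr k t.
  by rewrite natrB ?(ltnW ltkl) // rmorphB /= /fr; ring.
have /andP[k0 k1] := floor_itv (Q.+1%:R * fr k t).
have /andP[l0 l1] := floor_itv (Q.+1%:R * fr l t).
rewrite -/(box k t) bkl in k0 k1; rewrite -/(box l t) in l0 l1.
rewrite -[leRHS]mul1r ler_pdivlMr // -[X in _ * X]gtr0_norm // -normrM.
rewrite intrD in k1 l1; rewrite mulrC mulrBr ler_norml; lra.
Qed.

(** Normalize a basis of A by inverting d independent rows of its matrix. *)
Lemma echelon_vectors (R : realType) n (A : {vspace 'cV[R]_n}) d : \dim A = d ->
  exists (f : 'I_d -> 'I_n) (a : 'I_d -> 'cV[R]_n),
  [/\ injective f, forall i, a i \in A & forall i k, a i (f k) 0 = (i == k)%:R].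
Proof.
move=> <-; pose V : 'M[R]_(n, \dim A) := \matrix_(r, b) (vbasis A)`_b r 0.
have Vc (c : 'cV[R]_(\dim A)) : V *m c = \sum_b c b 0 *: (vbasis A)`_b.
  apply/colP => r; rewrite !mxE summxE; apply: eq_bigr => a _.
  by rewrite !mxE mulrC.
have Vfull : row_full V.
  rewrite /row_full -mxrank_tr -/(row_free V^T); apply: inj_row_free => c.
  move=> /(congr1 trmx); rewrite trmx_mul trmxK trmx0 Vc => c0.
  apply/rowP => b; rewrite [RHS]mxE.
  have /freeP/(_ _ c0 b) := basis_free (vbasisP A).
  by rewrite mxE.
pose N := V *m invmx (rowsub (fullrankfun Vfull) V).
exists (fullrankfun Vfull), (fun i => col i N); split.
- exact: fullrankfun_inj.
- move=> i; rewrite colE /N -mulmxA Vc; apply: memv_suml => b _; apply: memvZ.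
  by apply/vbasis_mem/mem_nth; rewrite size_tuple.
- move=> i k; have : rowsub (fullrankfun Vfull) N = 1%:M.
    by rewrite /N -mul_rowsub_mx mulmxV // fullrowsub_unit.
  by move=> /matrixP/(_ k i); rewrite !mxE eq_sym.
Qed.

(** The entries of a_i in the rows selected by f are 0 or 1, hence approximated
exactly by multiples of 1 / q; only the j * (n - d) others need Dirichlet's
theorem. *)
Lemma integer_approx (R : realType) n d j (f : 'I_d -> 'I_n) (a : 'I_d -> 'cV[R]_n)
    (jd : (j <= d)%N) (Q : nat) : injective f ->
  (forall i k, a i (f k) 0 = (i == k)%:R) -> (0 < Q)%N ->
  exists (q : nat) (M : 'M[int]_(n, j)),
  [/\ (0 < q <= Q ^ (j * (n - d)))%N,
      forall (i k : 'I_j), M (f (widen_ord jd k)) i = q%:Z *+ (i == k) &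
      forall r i, `|q%:R * a (widen_ord jd i) r 0 - (M r i)%:~R| <= Q%:R^-1].
Proof.
move=> f_inj af Q0.
pose S : finType := {r : 'I_n | r \notin codom f}.
have cardS : #|{: S}| = (n - d)%N.
  rewrite card_sig -[n in RHS]card_ord -[d in RHS]card_ord -(card_codom f_inj).
  by rewrite -(cardC (mem (codom f))) addKn; apply: eq_card.
have [q [p [qQ pP]]] := dirichlet (fun t : 'I_j * S =>
  a (widen_ord jd t.1) (val t.2) 0) Q0.
rewrite card_prod card_ord cardS in qQ.
exists q, (\matrix_(r, i) if insub r is Some s then p (i, s)
                          else q%:Z *+ (r == f (widen_ord jd i))); split => //.
  move=> i k; rewrite mxE insubF; last by rewrite codom_f.
  by rewrite (inj_eq f_inj) eq_sym.
move=> r i; rewrite mxE; case: insubP => [s _ sr|].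
  by have := pP (i, s); rewrite /= sr.
rewrite negbK => /codomP[k ->]; rewrite af (inj_eq f_inj) eq_sym.
by rewrite rmorphMn /= mulr_natr subrr normr0 invr_ge0 ler0n.
Qed.

(** The projection along B kills B and not v, and it is Lipschitz for the sup
norm. *)
Lemma not_mem_gap (R : realType) n (B : {vspace 'cV[R]_n}) v : v \notin B ->
  exists2 delta : R, 0 < delta &
    forall w, w \in B -> ~ (forall r, `|v r 0 - w r 0| <= delta).
Proof.
move=> vB; pose g : 'End('cV[R]_n) := (\1 - projv B)%VF.
have gE w : g w = w - projv B w by rewrite !lfunE /= !lfunE.
have gB w : w \in B -> g w = 0 by move=> wB; rewrite gE projv_id ?subrr.
have [r0 gv] : exists r0, g v r0 0 != 0.
  apply: contrapT => H; move/negP: vB; apply.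
  suff : g v = 0 by rewrite gE => /subr0_eq ->; exact: memv_proj.
  apply/colP => r; rewrite [RHS]mxE; apply/eqP/negPn/negP => h.
  by apply: H; exists r.
pose C := \sum_s `|g (delta_mx s 0) r0 0| + 1.
have C0 : 0 < C by rewrite ltr_wpDl // sumr_ge0.
have nv : 0 < `|g v r0 0| by rewrite normr_gt0.
exists (`|g v r0 0| / (2 * C)); first by rewrite divr_gt0 // mulr_gt0.
move=> w wB H; set D := _ / _ in H.
have : `|g v r0 0| <= D * C.
  have -> : g v = g (v - w) by rewrite linearB /= (gB w) // subr0.
  have -> : v - w = \sum_s (v - w) s 0 *: delta_mx s 0.
    by rewrite {1}[v - w]matrix_sum_delta; apply: eq_bigr => i _; rewrite big_ord1.
  rewrite linear_sum summxE (le_trans (ler_norm_sum _ _ _)) //.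
  have D0 : 0 <= D by rewrite divr_ge0 // mulr_ge0 // ltW.
  apply: (@le_trans _ _ (D * \sum_s `|g (delta_mx s 0) r0 0|)).
    rewrite mulr_sumr; apply: ler_sum => s _; rewrite linearZ /= !mxE normrM.
    by apply: ler_wpM2r => //; exact: H.
  by apply: ler_wpM2l => //; rewrite lerDl.
have -> : D * C = `|g v r0 0| / 2 by rewrite /D; field; rewrite gt_eqF.
lra.
Qed.

Lemma not_mem_gap_seq (R : realType) n j (a : 'I_j -> 'cV[R]_n) (s : seq {vspace 'cV[R]_n}) :
  (forall B, B \in s -> exists i, a i \notin B) ->
  exists2 delta : R, 0 < delta & forall B, B \in s ->
    ~ (forall i, exists2 w, w \in B & forall r, `|a i r 0 - w r 0| <= delta).
Proof.
elim: s => [|B s IH] H; first by exists 1.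
have [|d1 d10 d1P] := IH; first by move=> C Cs; apply: H; rewrite inE Cs orbT.
have [i aiB] := H B (mem_head _ _); have [d2 d20 d2P] := not_mem_gap aiB.
exists (Num.min d1 d2); first by rewrite lt_min d10.
move=> C; rewrite inE => /predU1P[->|Cs] h.
  have [w wB wP] := h i; apply: (d2P w wB) => r.
  by apply: le_trans (wP r) _; rewrite ge_min lexx orbT.
apply: (d1P C Cs) => k; have [w wC wP] := h k; exists w => // r.
by apply: le_trans (wP r) _; rewrite ge_min lexx.
Qed.

(** Otherwise the j independent vectors a_i lie in the intersection of A and B. *)
Lemma irrational_not_mem (R : realType) n d e j (A : {vspace 'cV[R]_n})
    (a : 'I_j -> 'cV[R]_n) (f : 'I_j -> 'I_n) B :
  irrational_subspaces R n d e j A -> (forall i, a i \in A) ->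
  (forall i k, a i (f k) 0 = (i == k)%:R) ->
  rational_subspaces R n e B -> exists i, a i \notin B.
Proof.
move=> [_ irr] aA af ratB; apply: contrapT => H.
have aB i : a i \in B by apply/negPn/negP => h; apply: H; exists i.
pose V : 'M[R]_(n, j) := \matrix_(r, i) a i r 0.
have Vfree : row_free V^T.
  apply: inj_row_free => v /rowP v0; apply/rowP => k.
  have := v0 (f k); rewrite !mxE (bigD1 k) //= big1 ?addr0 => [|i ik].
    by rewrite !mxE af eqxx mulr1.
  by rewrite !mxE af (negPf ik) mulr0.
have := irr B ratB; rewrite ltnNge => /negP; apply.
rewrite -[X in (X <= _)%N](dim_column_span Vfree); apply: dimvS.
apply/subvP => v /mem_column_span[c ->].
have -> : V *m c = \sum_i c i 0 *: a i.
  apply/colP => r; rewrite !mxE summxE; apply: eq_bigr => i _.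
  by rewrite !mxE mulrC.
by apply: memv_suml => i _; apply: memvZ; rewrite memv_cap aA aB.
Qed.

Lemma rational_column_span (R : realType) n k (N : 'M[int]_(n, k)) : gram N != 0 ->
  rational_subspaces R n k (column_span (map_mx intr N)).
Proof.
move=> G0; have Nf : row_free (map_mx (intr : int -> R) N)^T.
  by rewrite -gram_gt0 map_gram ltr0z lt0r G0 gram_ge0.
split; last exact: dim_column_span.
exists [seq col a (map_mx intr N) | a <- enum 'I_k]; first exact: column_span_basis.
move=> v /mapP[a _ ->] i; apply/rationalP; exists (N i a), 1%N.
by rewrite !mxE divr1.
Qed.

(** Schmidt's going-up principle, with an explicit constant. *)
Lemma rational_extension (R : realType) n j e (M : 'M[int]_(n, j)) :
  (j < n)%N -> (j <= e <= n)%N -> gram M != 0 ->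
  exists B : {vspace 'cV[R]_n},
  [/\ rational_subspaces R n e B, forall i, col i (map_mx intr M) \in B,
      0 < height B &
      height B <= Num.sqrt (expR (ln 4 * n%:R ^+ 2) *
        (gram M)%:~R `^ ((n%:R - e%:R) / (n%:R - j%:R)) *+ e`!)].
Proof.
move=> jn jen G0; have [u [u1 uM [E ME]]] := unimodular_saturation (ltnW jn) G0.
have [w [wj w1 wP]] := going_up R jn jen u1.
have Ge : gram (cols e w) != 0.
  by rewrite gt_eqF //; apply: (@gram_prefix_int n e n); [case/andP: jen|rewrite w1].
exists (column_span (map_mx intr (cols e w))).
have ratB := @rational_column_span R _ _ _ Ge.
have /andP[h0 hle] := height_bounds (proj2 ratB) erefl Ge.
split => // [i|].
  have [F wF] : exists F, cols j w = cols e w *m F.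
    by apply: column_comb_cols => b bj; apply: column_comb_mem;
      apply: leq_trans bj _; case/andP: jen.
  apply/mem_column_span; exists (col i (map_mx intr (F *m E))).
  by rewrite ME -wj wF -mulmxA !colE map_mxM mulmxA.
have th0 : 0 <= (n%:R - e%:R) / (n%:R - j%:R) :> R.
  by case/andP: jen => _ en; rewrite divr_ge0 // subr_ge0 ler_nat // ltnW.
apply: (le_trans hle); rewrite ler_sqrt; last first.
  by apply: mulrn_wge0; apply: mulr_ge0; [exact: expR_ge0|exact: powR_ge0].
rewrite lerMn2r; apply/orP; right; apply: (le_trans wP).
apply: ler_wpM2l; first exact: expR_ge0.
by apply: ge0_ler_powR; rewrite ?nnegrE ?ler0z ?gram_ge0 // ler_int.
Qed.

(** * The exponent *)

(** The subspaces B that realize the exponent.  Here K depends only on A and the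
dimensions, since the entries of the approximating integer matrix are O(q). *)
Lemma rational_neighbours (R : realType) n d e j (A : {vspace 'cV[R]_n}) :
  \dim A = d -> (0 < j <= d)%N -> (j <= e < n)%N ->
  exists (a : 'I_j -> 'cV[R]_n) (f : 'I_j -> 'I_n) (K : R),
  [/\ forall i, a i \in A, forall i k, a i (f k) 0 = (i == k)%:R, 0 < K &
   forall Q : nat, (0 < Q)%N -> (2 * (j ^ 2 * n) <= Q)%N ->
   exists (q : nat) (B : {vspace 'cV[R]_n}),
   [/\ (0 < q <= Q ^ (j * (n - d)))%N, rational_subspaces R n e B,
     0 < height B <= K * q%:R `^ (j%:R * (n%:R - e%:R) / (n%:R - j%:R)),
     psi_ j A B <= (2 * (j ^ 2 * n))%:R / (q%:R * Q%:R) &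
     forall i, exists2 w, w \in B & forall r, `|a i r 0 - w r 0| <= Q%:R^-1]].
Proof.
move=> Ad /andP[j0 jd] /andP[je en].
have [f [a [f_inj aA af]]] := echelon_vectors Ad.
pose a' i := a (widen_ord jd i); pose f' i := f (widen_ord jd i).
have af' i k : a' i (f' k) 0 = (i == k)%:R by rewrite af.
pose c : R := 1 + \sum_i \sum_r `|a i r 0|.
have ac i r : `|a i r 0| + 1 <= c.
  rewrite addrC lerD2l (bigD1 i) //= (bigD1 r) //= -addrA lerDl.
  by rewrite addr_ge0 // sumr_ge0 // => k _; rewrite sumr_ge0.
pose C : R := (c ^+ 2 *+ n) ^+ j *+ j`!.
pose th : R := (n%:R - e%:R) / (n%:R - j%:R).
pose K2 : R := expR (ln 4 * n%:R ^+ 2) * C `^ th *+ e`!.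
exists a', f', (Num.sqrt K2 + 1); split => //; first by move=> i; exact: aA.
move=> Q Q0 Q2.
have [q [M [/andP[q0 qQ] Mf Ma]]] := integer_approx jd f_inj af Q0.
have qR : 0 < q%:R :> R by rewrite ltr0n.
have QR : 0 < Q%:R :> R by rewrite ltr0n.
have Q1 : Q%:R^-1 <= 1 :> R by rewrite invf_le1 // ler1n.
have Gle : (gram M)%:~R <= (q%:R ^+ j) ^+ 2 * C.
  have -> : (q%:R ^+ j) ^+ 2 * C = ((q%:R * c) ^+ 2 *+ n) ^+ j *+ j`!.
    rewrite /C mulrnAr; congr (_ *+ _).
    by rewrite [(q%:R * c) ^+ 2]exprMn -[in RHS]mulrnAr [in RHS]exprMn [in LHS]exprAC.
  rewrite -map_gram; apply: gram_le => r i; rewrite mxE.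
  have := ler_normB (q%:R * a (widen_ord jd i) r 0)
    (q%:R * a (widen_ord jd i) r 0 - (M r i)%:~R).
  rewrite opprB addrC subrK => h; apply: (le_trans h).
  rewrite normrM (gtr0_norm qR).
  have := ler_wpM2l (ltW qR) (ac (widen_ord jd i) r).
  have : 1 <= q%:R :> R by rewrite ler1n.
  have := Ma r i; lra.
have G0 : gram M != 0.
  pose F := [ffun k => f' k].
  have MF : rowsub F M = (q%:Z)%:M.
    by apply/matrixP => k i; rewrite !mxE ffunE Mf eq_sym.
  suff : 0 < gram M *+ j`! by rewrite pmulrn_lgt0 ?fact_gt0 // lt0r => /andP[].
  rewrite gram_sum_minors (bigD1 F) //= MF det_scalar ltr_pwDl //.
    by rewrite exprn_gt0 // exprn_gt0 // ltz_nat.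
  by apply: sumr_ge0 => g _; rewrite sqr_ge0.
have jn : (j < n)%N by exact: leq_ltn_trans je en.
have jen : (j <= e <= n)%N by rewrite je ltnW.
have [B [ratB MB B0 Ble]] := rational_extension R jn jen G0.
have th0 : 0 <= th.
  by rewrite /th divr_ge0 // subr_ge0 ler_nat ltnW.
pose b i := q%:R^-1 *: col i (map_mx (intr : int -> R) M).
have bB i : b i \in B by apply: memvZ.
have bf i k : b i (f' k) 0 = (i == k)%:R.
  by rewrite !mxE Mf; case: (i == k); rewrite ?mulr0 // mulr1n mulVf // gt_eqF.
have ab i r : `|a' i r 0 - b i r 0| <= (q%:R * Q%:R)^-1.
  have -> : a' i r 0 - b i r 0 = q%:R^-1 * (q%:R * a' i r 0 - (M r i)%:~R).
    by rewrite !mxE mulrBr mulKf ?gt_eqF.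
  rewrite normrM gtr0_norm ?invr_gt0 // invfM ler_pM2l ?invr_gt0 //.
  exact: Ma.
have qQR : (q%:R * Q%:R)^-1 <= Q%:R^-1 :> R.
  by rewrite lef_pV2 ?posrE ?mulr_gt0 // ler_peMl ?ler1n // ltW.
exists q, B; split => //.
- by rewrite q0.
- rewrite B0 /=; apply: (le_trans Ble).
  apply: (@le_trans _ _ (Num.sqrt (K2 * (q%:R `^ (j%:R * th)) ^+ 2))).
    have pg : 0 <= (q%:R ^+ j) ^+ 2 :> R by rewrite sqr_ge0.
    have C0 : 0 <= C by rewrite mulrn_wge0 // exprn_ge0 // mulrn_wge0 // sqr_ge0.
    rewrite ler_sqrt; last first.
      apply: mulr_ge0; last exact: sqr_ge0.
      by apply: mulrn_wge0; apply: mulr_ge0; [exact: expR_ge0|exact: powR_ge0].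
    rewrite /K2 mulrnAl lerMn2r; apply/orP; right.
    rewrite -mulrA; apply: ler_wpM2l; first exact: expR_ge0.
    apply: (@le_trans _ _ (((q%:R ^+ j) ^+ 2 * C) `^ th)).
      apply: ge0_ler_powR => //; rewrite nnegrE.
        by rewrite ler0z gram_ge0.
      exact: mulr_ge0.
    rewrite powRM // mulrC; apply: ler_wpM2l; first exact: powR_ge0.
    by rewrite -(powR_mulrn j (ltW qR)) !expr2 powRM ?powR_ge0 // -powRrM.
  rewrite sqrtrM; last first.
    by apply: mulrn_wge0; apply: mulr_ge0; [exact: expR_ge0|exact: powR_ge0].
  rewrite sqrtr_sqr ger0_norm ?powR_ge0 //.
  have <- : j%:R * th = j%:R * (n%:R - e%:R) / (n%:R - j%:R) by rewrite /th mulrA.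
  by apply: ler_wpM2r; [exact: powR_ge0|rewrite lerDl].
- rewrite natrM; apply: (psi_close_le j0 _ bB bf ab).
    by move=> i; exact: aA.
  have := ler_nat R (2 * (j ^ 2 * n)) Q; rewrite Q2 natrM => Q2'.
  apply: (@le_trans _ _ ((j ^ 2 * n)%:R * Q%:R^-1)); first by rewrite ler_wpM2l.
  by rewrite ler_pdivrMr //; lra.
- move=> i; exists (b i) => // r; exact: le_trans (ab i r) qQR.
Qed.

Theorem mainTheorem4 (R : realType) (n d e j : nat)
    (hn : (4 <= n)%N)
    (hd : (1 <= d <= n - 1)%N) (he : (1 <= e <= n - 1)%N)
    (hde : (d + e <= n)%N)
    (hj : (1 <= j <= minn d e)%N) :
  (((n%:R - j%:R) *
      (j%:R * n%:R - j%:R * d%:R + j%:R ^+ 2 / 2 + j%:R / 2 + 1) /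
    (j%:R ^+ 2 * (n%:R - e%:R) * (n%:R - d%:R + j%:R / 2 + 1 / 2)) : R)%:E
     <= mu_ring R n d e j)%E.
Proof.
set tau : R := (X in EFin X).
apply/ereal_infP => _ [A irrA <-]; apply: ereal_sup_ubound; exists tau => //.
have [j0 jd je] : [/\ (0 < j)%N, (j <= d)%N & (j <= e)%N].
  by move: hj; rewrite leq_min => /andP[? /andP[]].
have [dn en] : (d < n)%N /\ (e < n)%N by lia.
have jR : 1 <= j%:R :> R by rewrite ler1n.
have jdR : j%:R <= d%:R :> R by rewrite ler_nat.
have jeR : j%:R <= e%:R :> R by rewrite ler_nat.
have dnR : d%:R < n%:R :> R by rewrite ltr_nat.
have enR : e%:R < n%:R :> R by rewrite ltr_nat.
pose D : R := n%:R - d%:R + j%:R / 2 + 1 / 2.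
pose s : R := (j%:R * D)^-1.
pose al : R := j%:R * (n%:R - e%:R) / (n%:R - j%:R).
have D0 : 0 < D by rewrite /D; lra.
have s0 : 0 < s by rewrite invr_gt0 mulr_gt0 //; lra.
have al0 : 0 < al by rewrite divr_gt0 ?mulr_gt0 //; lra.
have altau : al * tau = 1 + s.
  have key (J N E F : R) : J != 0 -> N - E != 0 -> N - J != 0 -> F != 0 ->
      J * (N - E) / (N - J) * ((N - J) * (J * F + 1) / (J ^+ 2 * (N - E) * F)) =
      1 + (J * F)^-1.
    by move=> *; field; do !(apply/andP; split).
  rewrite -(key j%:R n%:R e%:R D); try by rewrite gt_eqF //; lra.
  by rewrite /al /tau /D; congr (_ * (_ * _ / _)); field.
have tau0 : 0 < tau by rewrite -(pmulr_rgt0 _ al0) altau; lra.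
split => //.
have [a [f [K [aA af K0 HQ]]]] :=
  rational_neighbours (proj1 irrA) (introT andP (conj j0 jd))
    (introT andP (conj je en)).
move=> /finite_seqP[S SE].
have Sgap B : B \in S -> exists i, a i \notin B.
  move=> BS; have : [set` S]%classic B by [].
  by rewrite -SE => -[ratB _]; exact: (irrational_not_mem irrA aA af ratB).
have [delta delta0 gap] := not_mem_gap_seq Sgap.
(* q <= Q ^ (j (n - d)) gives q `^ s <= Q `^ rho; that rho < 1 is exactly the
   gain from n - d to n - d + j / 2 + 1 / 2. *)
pose rho : R := (j * (n - d))%:R * s.
have rho1 : rho < 1.
  rewrite /rho /s natrM natrB ?(ltnW dn) // -ltr_pdivlMr ?invr_gt0 ?mulr_gt0 ?invrK //; try lra.
  by rewrite mul1r /D ltr_pM2l; lra.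
(* The value for which Q `^ (1 - rho) >= c K `^ tau as soon as Q >= L. *)
pose L : R := ((2 * (j ^ 2 * n))%:R * K `^ tau) `^ (1 - rho)^-1.
have above (x : R) : 0 <= x -> exists k : nat, x <= k%:R.
  by move=> x0; exists (Num.bound x); exact/ltW/archi_boundP.
have [b1 b1P] := above L (powR_ge0 _ _).
have [|b2 b2P] := above delta^-1; first by rewrite invr_ge0 ltW.
have [Q [Q0 Qj b1Q b2Q]] : exists Q : nat,
    [/\ (0 < Q)%N, (2 * (j ^ 2 * n) <= Q)%N, (b1 <= Q)%N & (b2 <= Q)%N].
  exists (maxn (2 * (j ^ 2 * n)) (maxn b1 b2)).+1.
  by split => //; apply: leqW; rewrite !leq_max leqnn ?orbT.
have QR : 0 < Q%:R :> R by rewrite ltr0n.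
have QL : L <= Q%:R by apply: le_trans b1P _; rewrite ler_nat.
have Qdelta : Q%:R^-1 <= delta.
  rewrite -[delta]invrK lef_pV2 ?posrE ?invr_gt0 //.
  by apply: le_trans b2P _; rewrite ler_nat.
have [q [B [/andP[q0 qQ] ratB /andP[h0 hK] psiB near]]] := HQ Q Q0 Qj.
have qR : 0 < q%:R :> R by rewrite ltr0n.
suff BS : B \in S.
  apply: (gap B BS) => i; have [w wB wP] := near i; exists w => // r.
  exact: le_trans (wP r) Qdelta.
suff : [set` S]%classic B by [].
rewrite -SE; split => //; apply: (le_trans psiB).
rewrite powRN -[leRHS]mul1r ler_pdivlMr ?powR_gt0 // mulrAC ler_pdivrMr ?mulr_gt0 // mul1r.
have hq : height B `^ tau <= K `^ tau * (q%:R * q%:R `^ s).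
  have -> : q%:R * q%:R `^ s = (q%:R `^ al) `^ tau.
    rewrite -powRrM altau powRD ?powRr1 ?(ltW qR) //.
    by rewrite (gt_eqF qR) implybT.
  rewrite -powRM; [|exact: ltW|exact: powR_ge0].
  apply: ge0_ler_powR => //; rewrite ?nnegrE; [exact: ltW|exact: ltW|].
  by rewrite mulr_ge0 ?powR_ge0 // ltW.
have qs : q%:R `^ s <= Q%:R `^ rho.
  rewrite /rho powRrM powR_mulrn ?(ltW QR) //.
  apply: ge0_ler_powR; rewrite ?nnegrE ?exprn_ge0 ?(ltW s0) ?ler0n //.
  by rewrite -natrX ler_nat.
have KQ : (2 * (j ^ 2 * n))%:R * K `^ tau * Q%:R `^ rho <= Q%:R.
  have QE : Q%:R = Q%:R `^ (1 - rho) * Q%:R `^ rho.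
    rewrite -powRD; last by rewrite (gt_eqF QR) implybT.
    by rewrite subrK powRr1 // ltW.
  rewrite [leRHS]QE ler_wpM2r ?powR_ge0 //.
  have r1 : 0 < 1 - rho by rewrite subr_gt0.
  have := ge0_ler_powR (ltW r1) _ _ QL; rewrite !nnegrE => /(_ (powR_ge0 _ _) (ltW QR)).
  rewrite /L -powRrM mulVf ?gt_eqF // powRr1 // mulr_ge0 ?powR_ge0 //.
have k0 : 0 <= (2 * (j ^ 2 * n))%:R :> R by rewrite ler0n.
apply: (le_trans (ler_wpM2l k0 hq)).
set c := (2 * _)%:R in KQ k0 *.
have -> : c * (K `^ tau * (q%:R * q%:R `^ s)) = q%:R * (c * K `^ tau * q%:R `^ s) by ring.
rewrite ler_pM2l //; apply: le_trans KQ.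
by rewrite ler_wpM2l // mulr_ge0 ?powR_ge0.
Qed.
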